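(* Let $p\ge3$, let $D\subseteq\mathbb{D}$ be an open set with the $p$-th Hindmarsh property, let $f:D\to\mathbb{C}$ and let $\kappa\ge0$ be an integer. Then $f\in\mathcal{S}_\kappa(D)$ if and only if $\mathbf{k}_n(f)=\mathbf{k}_{n+p}(f)=\kappa$ for some integer $n\ge0$.
   Context: $\mathbb{D}$ is the open unit disk. A Schur function is an analytic $S:\mathbb{D}\to\mathbb{C}$ with $|S|\le1$. Pick matrix: $P_n(f;z_1,\dots,z_n)=\left[\frac{1-f(z_i)\overline{f(z_j)}}{1-z_i\overline{z_j}}\right]_{i,j=1}^n$ for distinct $z_i\in D$. $\mathrm{sq}_-P$ = number of negative eigenvalues (with multiplicity) of a Hermitian $P$. $\mathbf{k}_n(f)=\max\mathrm{sq}_-P_n(f;z_1,\dots,z_n)$ over distinct $z_1,\dots,z_n\in D$, and $\mathbf{k}_0(f)=0$. $\mathcal{S}_\kappa(D)$ is the set of functions $f:D\to\mathbb{C}$ all of whose Pick matrices (at distinct points of $D$) have at most $\kappa$ negative eigenvalues, with at least one having exactly $\kappa$. For an integer $k\ge3$, an open set $D\subseteq\mathbb{D}$ has the $k$-th Hindmarsh property if every function $g:D\to\mathbb{C}$ such that $P_k(g;z_1,\dots,z_k)\ge0$ for all distinct $z_1,\dots,z_k\in D$ admits an extension to a Schur function on $\mathbb{D}$. *)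

(* Defs.v *)
(* The complex plane is R[i] for R : realType. *)
From HB Require Import structures.
From mathcomp Require Import all_boot all_order all_algebra.
From mathcomp Require Import all_classical all_reals all_analysis.
From mathcomp Require Import complex.
Import Order.TTheory GRing.Theory Num.Theory numFieldNormedType.Exports.

Set Implicit Arguments.
Unset Strict Implicit.
Unset Printing Implicit Defensive.

Local Open Scope ring_scope.
Local Open Scope classical_set_scope.

(* Topology / metric on C = R[i] induced by the complex modulus |.|
   (the generic numFieldType structure, instantiated on R[i]). *)
HB.instance Definition _ (R : rcfType) := PseudoPointedMetric.copy R[i] (R[i])^o.

Section Defs.
Variable R : realType.
Local Notation C := R[i].

(* the open unit disk *)
Definition unit_disk : set C := [set z | `|z| < 1].

(* f is analytic on the open set U: near each point of U it is the sum of a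
   convergent power series. *)
Definition analytic_on (U : set C) (f : C -> C) : Prop :=
  forall z0, U z0 -> exists r : C, 0 < r /\ exists a : nat -> C,
    forall z, `|z - z0| < r ->
      (fun N => \sum_(0 <= k < N) a k * (z - z0) ^+ k) @ \oo --> f z.

(* Schur function: analytic S on the unit disk with |S| <= 1 there. *)
Definition schur (S : C -> C) : Prop :=
  analytic_on unit_disk S /\ forall z, unit_disk z -> `|S z| <= 1.

(* Pick matrix of f at the points z_1, ..., z_n. *)
Definition pick (n : nat) (f : C -> C) (z : 'I_n -> C) : 'M[C]_n :=
  \matrix_(i, j) ((1 - f (z i) * (f (z j))^*) / (1 - z i * (z j)^*)).

(* eigenvalues (with algebraic multiplicity) of a square complex matrix:
   a list s with char_poly A = prod_(x <- s) ('X - x). *)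
Lemma char_poly_splits n (A : 'M[C]_n) :
  exists s : seq C, char_poly A == \prod_(x <- s) ('X - x%:P).
Proof.
have [s Hs] := closed_field_poly_normal (char_poly A).
by exists s; apply/eqP; rewrite {1}Hs (eqP (char_poly_monic A)) scale1r.
Qed.

Definition eigenvalues n (A : 'M[C]_n) : seq C := xchoose (char_poly_splits A).

(* sq_- A : number of negative eigenvalues counted with multiplicity *)
Definition sq_minus n (A : 'M[C]_n) : nat := count (fun x => x < 0) (eigenvalues A).

(* positive semidefinite: v^* A v >= 0 for all v *)
Definition psd n (A : 'M[C]_n) : Prop :=
  forall v : 'cV[C]_n, 0 <= \sum_i \sum_j (v i 0)^* * A i j * v j 0.

(* "distinct points of D" *)
Definition points_in (D : set C) n (z : 'I_n -> C) : Prop :=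
  injective z /\ forall i, D (z i).

(* k_n(f) = k : the maximum of sq_- over Pick matrices at n distinct points of D
   exists and equals k (for n = 0 this gives k = 0). *)
Definition kn_eq (D : set C) (f : C -> C) (n k : nat) : Prop :=
  (exists z : 'I_n -> C, points_in D z /\ sq_minus (pick f z) = k) /\
  (forall z : 'I_n -> C, points_in D z -> (sq_minus (pick f z) <= k)%N).

(* f in S_kappa(D) *)
Definition S_kappa (D : set C) (kappa : nat) (f : C -> C) : Prop :=
  (forall n (z : 'I_n -> C), (0 < n)%N -> points_in D z ->
     (sq_minus (pick f z) <= kappa)%N) /\
  (exists n (z : 'I_n -> C), (0 < n)%N /\ points_in D z /\
     sq_minus (pick f z) = kappa).

(* k-th Hindmarsh property of D *)
Definition hindmarsh (k : nat) (D : set C) : Prop :=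
  forall g : C -> C,
    (forall z : 'I_k -> C, points_in D z -> psd (pick g z)) ->
    exists S : C -> C, schur S /\ forall z, D z -> S z = g z.

End Defs.

(* Main.v *)
Require Import Defs.
From HB Require Import structures.
From mathcomp Require Import all_boot all_order all_algebra.
From mathcomp Require Import all_classical all_reals all_analysis.
From mathcomp Require Import complex.
From mathcomp Require Import ring lra.
Import Order.TTheory GRing.Theory Num.Theory numFieldNormedType.Exports.
Local Open Scope ring_scope.
Local Open Scope classical_set_scope.

(** Shrink an n-point configuration realising kappa negative squares until its
    Pick matrix P is invertible.  The Schur complement of P in a larger Pick
    matrix of f is, up to a diagonal congruence, the Pick matrix of a function
    g = pick_num / pick_den, the image of f under the linear fractional map that
    eliminates the nodes.  Since k_(n+p) = kappa, all p-point Pick matrices of g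
    off the nodes are positive semidefinite; g extends to the nodes by taking
    cluster values, so the Hindmarsh property makes it a Schur function.  Hence
    all its Pick matrices are positive semidefinite, and undoing the Schur
    complement bounds the negative squares of every Pick matrix of f by kappa.

    That a Schur function has positive semidefinite Pick matrices is proved by
    Schur's algorithm, with the maximum principle derived directly from local
    power series expansions. *)

Set Implicit Arguments.
Unset Strict Implicit.
Unset Printing Implicit Defensive.

(** * Negative subspaces of Hermitian matrices and elimination of nodes *)

Section Inertia.
Variable C : numClosedFieldType.

(** Eigenvalue counts are replaced by negative subspaces, which pass directly through congruences
    and submatrices. Shrinking the realising configuration serves two ends: [P] becomes invertible,
    and its n0 <= n points together with p new ones stay within n + p points, where the bound kappa
    is known because smaller configurations extend to larger ones. A negative direction of the Schur
    complement on p new points would be the (kappa+1)-th, hence its positivity. Off the nodes the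
    denominator of g cannot vanish: positivity on the diagonal gives |num| <= |den|, and the two
    have no common zero there. At a node both vanish, so g carries no information, whereas the
    Hindmarsh property speaks of all tuples in D; this forces the extension. Afterwards only points
    off the nodes enter the Schur complement, so any admissible values at the nodes serve. *)

Definition adjmx m n (A : 'M[C]_(m, n)) : 'M[C]_(n, m) := map_mx Num.conj A^T.
Local Notation "A ^H" := (adjmx A) (at level 8, format "A ^H").

Lemma adjmxE m n (A : 'M[C]_(m, n)) i j : A^H i j = (A j i)^*.
Proof. by rewrite !mxE. Qed.

Lemma adjmxK m n (A : 'M[C]_(m, n)) : A^H^H = A.
Proof. by apply/matrixP => i j; rewrite !adjmxE conjCK. Qed.

Lemma adjmxM m n p (A : 'M[C]_(m, n)) (B : 'M[C]_(n, p)) :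
  (A *m B)^H = B^H *m A^H.
Proof. by rewrite /adjmx trmx_mul map_mxM. Qed.

Lemma adjmxD m n (A B : 'M[C]_(m, n)) : (A + B)^H = A^H + B^H.
Proof. by rewrite /adjmx linearD /= map_mxD. Qed.

Lemma adjmxN m n (A : 'M[C]_(m, n)) : (- A)^H = - A^H.
Proof. by rewrite /adjmx linearN /= map_mxN. Qed.

Lemma adjmxZ m n a (A : 'M[C]_(m, n)) : (a *: A)^H = a^* *: A^H.
Proof. by rewrite /adjmx linearZ /= map_mxZ. Qed.

Lemma adjmx_inv n (A : 'M[C]_n) : (invmx A)^H = invmx A^H.
Proof. by rewrite /adjmx trmx_inv map_invmx. Qed.

Definition qform n (A : 'M[C]_n) (v : 'cV[C]_n) : C := (v^H *m A *m v) 0 0.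

(** Strict negativity at every nonzero [x] already makes [V] injective, so its columns span a space
    of dimension [m] without a rank condition. *)
Definition neg_subspace n (A : 'M[C]_n) m : Prop :=
  exists V : 'M[C]_(n, m), forall x, x != 0 -> qform A (V *m x) < 0.

Lemma qform_real n (A : 'M[C]_n) v : A^H = A -> qform A v \is Num.real.
Proof.
move=> hA; apply/CrealP; rewrite /qform -adjmxE.
by rewrite !adjmxM adjmxK hA mulmxA.
Qed.

Lemma qform_cong n m (A : 'M[C]_n) (E : 'M[C]_(n, m)) x :
  qform (E^H *m A *m E) x = qform A (E *m x).
Proof. by rewrite /qform adjmxM !mulmxA. Qed.

Lemma neg_subspace_cong n m (A : 'M[C]_n) (E : 'M[C]_(n, m)) k :
  neg_subspace (E^H *m A *m E) k -> neg_subspace A k.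
Proof.
by case=> V HV; exists (E *m V) => x /HV; rewrite qform_cong mulmxA.
Qed.

Lemma qform_diag n (d : 'rV[C]_n) v :
  qform (diag_mx d) v = \sum_i d 0 i * `|v i 0| ^+ 2.
Proof.
rewrite /qform mul_mx_diag mxE; apply: eq_bigr => i _.
by rewrite mxE adjmxE normCK; ring.
Qed.

Lemma hermitian_unitary_diag n (A : 'M[C]_n) : A^H = A ->
  exists (U : 'M[C]_n) (d : 'rV[C]_n), [/\ U *m U^H = 1%:M,
    A = U^H *m diag_mx d *m U & forall i, d 0 i \is Num.real].
Proof.
move=> hA; have hA' : A \is hermsymmx.
  by apply/is_hermitianmxP; rewrite expr0 scale1r -{1}hA.
exists (spectralmx A), (spectral_diag A); split.
- by apply/unitarymxP; exact: spectral_unitarymx.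
- have /hermitian_normalmx/orthomx_spectralP {1}-> := hA'.
  by rewrite invmx_unitary // spectral_unitarymx.
- by move=> i; apply: (mxOverP (hermitian_spectral_diag_real hA')).
Qed.

Lemma char_poly_similar n (A U V : 'M[C]_n) : U *m V = 1%:M ->
  char_poly (V *m A *m U) = char_poly A.
Proof.
move=> UV; have VU := mulmx1C UV; rewrite /char_poly /char_poly_mx.
have -> : 'X%:M - map_mx polyC (V *m A *m U) =
    map_mx polyC V *m ('X%:M - map_mx polyC A) *m map_mx polyC U.
  rewrite mulmxBr mulmxBl !map_mxM /=; congr (_ - _).
  by rewrite scalar_mxC -mulmxA -map_mxM VU map_scalar_mx rmorph1 mulmx1.
rewrite !det_mulmx mulrC mulrA -det_mulmx -map_mxM UV map_scalar_mx rmorph1.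
by rewrite det1 mul1r.
Qed.

Lemma char_poly_diag n (d : 'rV[C]_n) :
  char_poly (diag_mx d) = \prod_(x <- [seq d 0 i | i <- enum 'I_n]) ('X - x%:P).
Proof.
rewrite char_poly_trig ?diag_mx_is_trig // big_map big_enum /=.
by apply: eq_bigr => i _; rewrite mxE eqxx.
Qed.

Lemma neg_spectrum_card n (A U : 'M[C]_n) (d : 'rV[C]_n) (s : seq C) :
  U *m U^H = 1%:M -> A = U^H *m diag_mx d *m U ->
  char_poly A = \prod_(x <- s) ('X - x%:P) ->
  count (fun x => x < 0) s = #|[pred i | d 0 i < 0]|.
Proof.
move=> UU -> ; rewrite char_poly_similar // char_poly_diag.
move/prod_XsubC_eq/permP <-.
by rewrite count_map -sum1_count big_enum_cond -sum1_card; exact: eq_bigl.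
Qed.

Lemma neg_subspace_le n m k (A : 'M[C]_n) : (m <= k)%N ->
  neg_subspace A k -> neg_subspace A m.
Proof.
move=> /subnKC <- [V HV]; exists (V *m col_mx 1%:M 0) => x x0.
rewrite -mulmxA; apply: HV; apply: contra x0 => /eqP.
by rewrite mul_col_mx mul1mx => /eqP; rewrite col_mx_eq0 => /andP[].
Qed.

(** In an orthonormal eigenbasis the negative coordinates span a negative subspace. Conversely, a
    subspace of larger dimension contains a nonzero vector whose negative coordinates all vanish,
    and the form is nonnegative there. *)
Lemma neg_subspace_eigenvalues n (A : 'M[C]_n) (s : seq C) : A^H = A ->
  char_poly A = \prod_(x <- s) ('X - x%:P) ->
  forall m, (m <= count (fun x => x < 0)%R s)%N <-> neg_subspace A m.
Proof.
move=> hA cA m; have [U [d [UU dA rd]]] := hermitian_unitary_diag hA.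
rewrite (neg_spectrum_card UU dA cA); set I := [pred i | _].
split=> [le_m|[V HV]].
  apply: (neg_subspace_le le_m).
  exists (U^H *m \matrix_(i, j) (i == enum_val j)%:R) => x x0.
  rewrite dA qform_cong !mulmxA UU mul1mx.
  set E := \matrix_(i, j) _.
  have Ex j : (E *m x) (enum_val j) 0 = x j 0.
    rewrite mxE (bigD1 j) //= mxE eqxx mul1r big1 ?addr0 // => i ij.
    by rewrite mxE (inj_eq enum_val_inj) eq_sym (negPf ij) mul0r.
  have Ex0 i : i \notin I -> (E *m x) i 0 = 0.
    move=> iI; rewrite mxE big1 // => j _; rewrite mxE.
    by case: eqP iI => [->|_ _]; rewrite ?enum_valP ?mul0r.
  rewrite qform_diag (bigID [in I]) /= [X in _ + X]big1 ?addr0; last first.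
    by move=> i /Ex0 ->; rewrite normr0 expr0n mulr0.
  have [j xj] : exists j, x j 0 != 0.
    apply/existsP; apply: contraR x0 => /existsPn h.
    by apply/eqP/colP => j; rewrite mxE; apply/eqP; have := h j; rewrite negbK.
  rewrite (bigD1 (enum_val j)) /=; last exact: enum_valP.
  apply: ltr_nwDl.
    by rewrite Ex nmulr_rlt0 ?exprn_gt0 ?normr_gt0 //; exact: (enum_valP j).
  apply: sumr_le0 => i /andP[/= iI _].
  by rewrite mulr_le0_ge0 ?exprn_ge0 // ltW.
rewrite leqNgt; apply/negP => lt_m.
(* The negative coordinates of the columns of [V]: fewer rows than columns, hence a nontrivial
   kernel. *)
pose W : 'M[C]_(#|I|, m) := rowsub (fun j => enum_val j) (U *m V).
have : (kermx W^T != 0).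
  rewrite -mxrank_eq0 mxrank_ker mxrank_tr subn_eq0 -ltnNge.
  exact: leq_ltn_trans (rank_leq_row _) lt_m.
case/rowV0Pn => y /sub_kermxP yW y0.
have y0' : y^T != 0 by rewrite -(inj_eq trmx_inj) trmxK trmx0.
have := HV _ y0'; apply/negP; rewrite -real_leNgt ?real0 //; last first.
  exact: qform_real.
rewrite dA qform_cong qform_diag; apply: sumr_ge0 => i _.
have [iI|iI] := boolP (i \in I); last first.
  rewrite mulr_ge0 ?exprn_ge0 // real_leNgt ?real0 //.
have -> : (U *m (V *m y^T)) i 0 = 0.
  have := congr1 (fun M : 'M[C]_(1, #|I|) => M 0 (enum_rank_in iI i)) yW.
  rewrite mulmxA !mxE => h; rewrite -[RHS]h; apply: eq_bigr => j _.
  by rewrite !mxE enum_rankK_in // mulrC.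
by rewrite normr0 expr0n mulr0.
Qed.

(** Selecting rows and columns is congruence by a 0/1 matrix, so [s] may repeat indices; a list of
    points with repetitions can thus be read off a larger configuration. *)
Lemma neg_subspace_sub n m (A : 'M[C]_n) (s : 'I_m -> 'I_n) k :
  neg_subspace (mxsub s s A) k -> neg_subspace A k.
Proof.
pose E : 'M[C]_(n, m) := \matrix_(i, j) (i == s j)%:R.
suff -> : mxsub s s A = E^H *m A *m E by exact: neg_subspace_cong.
have AE p (B : 'M[C]_(p, n)) i j : (B *m E) i j = B i (s j).
  rewrite mxE (bigD1 (s j)) //= mxE eqxx mulr1 big1 ?addr0 // => l lj.
  by rewrite mxE (negPf lj) mulr0.
apply/matrixP => i j; rewrite AE -[A in RHS]adjmxK -adjmxM adjmxE AE adjmxE.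
by rewrite conjCK mxE.
Qed.

(* The form descends to the quotient by a kernel vector [x], and the
   hyperplane of vectors vanishing at a coordinate where [x] does not is a
   complement of [x]. *)
Lemma neg_subspace_singular n (A : 'M[C]_n.+1) k : A^H = A ->
  A \notin unitmx -> neg_subspace A k ->
  exists i, neg_subspace (mxsub (lift i) (lift i) A) k.
Proof.
move=> hA; rewrite -row_free_unit -kermx_eq0 => /rowV0Pn[y /sub_kermxP yA y0].
have [i yi] : exists i, y 0 i != 0.
  apply/existsP; apply: contraR y0 => /existsPn h.
  by apply/eqP/rowP => j; rewrite mxE; apply/eqP; have := h j; rewrite negbK.
case=> V HV; exists i.
pose x := y^H; have Ax : A *m x = 0.
  by rewrite -[A]hA -adjmxM yA; apply/matrixP => a b; rewrite !mxE conjC0.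
have xA : x^H *m A = 0 by rewrite adjmxK.
have xi : x i 0 != 0 by rewrite adjmxE conjC_eq0.
clearbody x.
(* Each column of [V] is corrected by the multiple of [x] that clears its entry [i]; the form does
   not see multiples of the kernel vector. *)
pose W := V - x *m ((x i 0)^-1 *: row i V).
exists (row' i W) => z /HV; rewrite (_ : qform A (V *m z) = qform A (W *m z)).
  suff -> : qform (mxsub (lift i) (lift i) A) (row' i W *m z) = qform A (W *m z).
    by [].
  have W0 : (W *m z) i 0 = 0.
    rewrite mxE big1 // => j _; rewrite !mxE big_ord1 !mxE.
    by rewrite mulVKf // subrr mul0r.
  rewrite row'Esub mul_rowsub_mx; set w := W *m z in W0 *.
  rewrite /qform !mxE (bigD1_ord i) //= W0 mulr0 add0r; apply: eq_bigr => j _.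
  rewrite !mxE (bigD1_ord i) //= adjmxE W0 conjC0 mul0r add0r; congr (_ * _).
  by apply: eq_bigr => l _; rewrite !mxE.
rewrite /W mulmxBl -mulmxA; set c := _ *: _ *m z.
have e1 : A *m (V *m z - x *m c) = A *m (V *m z).
  by rewrite mulmxBr (mulmxA A x) Ax mul0mx subr0.
have e2 : (V *m z - x *m c)^H *m A = (V *m z)^H *m A.
  by rewrite adjmxD adjmxN mulmxBl (adjmxM x) -[_ *m x^H *m _]mulmxA xA mulmx0 subr0.
by rewrite /qform e2 -!mulmxA e1.
Qed.

Lemma addmxE p q (M N : 'M[C]_(p, q)) i j : (M + N) i j = M i j + N i j.
Proof. by rewrite mxE. Qed.

Lemma oppmxE p q (M : 'M[C]_(p, q)) i j : (- M) i j = - M i j.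
Proof. by rewrite mxE. Qed.

(** * Schur complements and negative subspaces *)

Section SchurComplement.
Variables (n m : nat) (P : 'M[C]_n) (B : 'M[C]_(n, m)) (D : 'M[C]_m).
Hypotheses (hP : P^H = P) (uP : P \in unitmx).

Definition schur_compl := D - B^H *m invmx P *m B.

(** Completion of the square in [u]. *)
Lemma qform_block u w : qform (block_mx P B B^H D) (col_mx u w) =
  qform P (u + invmx P *m B *m w) + qform schur_compl w.
Proof.
rewrite /qform /adjmx tr_col_mx map_row_mx mul_row_block mul_row_col.
rewrite -!/(adjmx _) /schur_compl adjmxD !adjmxM adjmx_inv hP.
rewrite !(mulmxDl, mulmxDr, mulmxBr, mulmxBl, mulmxN, mulNmx) -!mulmxA.
rewrite !(mulKVmx uP) !(mulKmx uP) ?(mulKVmx uP).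
rewrite !(addmxE, oppmxE).
ring.
Qed.

(** A vector [w] negative for the Schur complement lifts to (-P^-1 B w, w), which is orthogonal for
    the block form to the first summand; added to a negative subspace of [P], it raises the
    dimension by one. *)
Lemma schur_compl_psd k : D^H = D -> neg_subspace P k ->
  ~ neg_subspace (block_mx P B B^H D) k.+1 ->
  forall w, 0 <= qform schur_compl w.
Proof.
move=> hD [V HV] nB w; have rw : qform schur_compl w \is Num.real.
  apply: qform_real; rewrite /schur_compl adjmxD adjmxN hD !adjmxM adjmxK.
  by rewrite adjmx_inv hP mulmxA.
 rewrite real_leNgt ?real0 //; apply/negP => w0.
apply: nB; rewrite -addn1.
exists (block_mx V (- (invmx P *m B *m w)) 0 w) => x x0.
rewrite -[x]vsubmxK mul_block_col mul0mx add0r mulNmx qform_block.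
rewrite -[invmx P *m B *m w *m _]mulmxA subrK.
set a := usubmx x; set b := dsubmx x.
have -> : qform schur_compl (w *m b) = `|b 0 0| ^+ 2 * qform schur_compl w.
  rewrite [b]mx11_scalar mul_mx_scalar /qform adjmxZ -!scalemxAl -scalemxAr.
  by rewrite !mxE eqxx mulr1n normCK; ring.
have [a0|a0] := eqVneq a 0; last first.
  by apply: ltr_nwDl; [exact: HV|rewrite mulr_ge0_le0 ?exprn_ge0 // ltW].
rewrite a0 mulmx0 /qform mulmx0 mxE add0r nmulr_llt0 // exprn_gt0 // normr_gt0.
apply: contra x0 => /eqP b0; rewrite -[x]vsubmxK -/a -/b a0.
by rewrite [b]mx11_scalar b0 raddf0 col_mx0.
Qed.

(** When the Schur complement is nonnegative, the map (u, w) -> u + P^-1 B w does not increase the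
    form, so it carries negative subspaces to negative subspaces. *)
Lemma neg_subspace_schur k : (forall w, 0 <= qform schur_compl w) ->
  neg_subspace (block_mx P B B^H D) k -> neg_subspace P k.
Proof.
move=> S0 [V HV]; exists (usubmx V + invmx P *m B *m dsubmx V) => x /HV.
rewrite -[V in V *m x]vsubmxK mul_col_mx qform_block mulmxDl -(mulmxA _ _ x).
by apply: le_lt_trans; rewrite lerDl.
Qed.

End SchurComplement.

(** * Elimination of nodes as a linear fractional map *)

Section PickKernel.
Variables (f : C -> C) (n : nat) (z : 'I_n -> C).

Definition pick_kernel x y : C := (1 - f x * (f y)^*) / (1 - x * y^*).

Definition pick_matrix : 'M[C]_n := \matrix_(i, j) pick_kernel (z i) (z j).

Definition pick_row x : 'rV[C]_n := \row_j pick_kernel x (z j).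

Lemma conj_pick_kernel x y : (pick_kernel x y)^* = pick_kernel y x.
Proof.
rewrite /pick_kernel rmorphM fmorphV !rmorphB !rmorphM rmorph1 /= !conjCK.
by rewrite [_^* * f y]mulrC [_^* * y]mulrC.
Qed.

Lemma pick_matrix_herm : pick_matrix^H = pick_matrix.
Proof. by apply/matrixP => i j; rewrite adjmxE !mxE conj_pick_kernel. Qed.

Hypotheses (zD : forall i, `|z i| < 1) (uP : pick_matrix \in unitmx).

Lemma one_sub_mul_conj_neq0 (x y : C) : `|x| < 1 -> `|y| < 1 -> 1 - x * y^* != 0.
Proof.
move=> x1 y1; rewrite subr_eq0; apply/eqP => e.
have : `|x * y^*| < 1 by rewrite normrM norm_conjC mulr_ilt1.
by rewrite -e normr1 ltxx.
Qed.

Lemma one_sub_neq0 (x : C) : `|x| < 1 -> 1 - x != 0.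
Proof.
by move=> x1; rewrite subr_eq0; apply: contraTneq x1 => <-; rewrite normr1 ltxx.
Qed.

Let P := pick_matrix.
Let Z : 'M[C]_n := diag_mx (\row_j z j).
Let A : 'M[C]_n := diag_mx (\row_j (1 - z j)^-1).
Let e : 'cV[C]_n := const_mx 1.
Let F : 'cV[C]_n := \col_j f (z j).
Let u x := pick_row x *m invmx P.

(* Row [1, f x] times the J-unitary matrix function that realises the
   elimination of the nodes [z], normalised to be the identity at 1. *)
Definition pick_num x : C := f x - (1 - x) * (u x *m A *m F) 0 0.
Definition pick_den x : C := 1 - (1 - x) * (u x *m A *m e) 0 0.

Let uPE x : u x *m P = pick_row x.
Proof. by rewrite /u mulmxKV. Qed.

Let AZ : A *m Z = A - 1%:M.
Proof.
apply/matrixP => i j; rewrite mul_diag_mx !mxE; case: eqP => [->|_].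
  by rewrite !mulr1n; have := one_sub_neq0 (zD j) => ?; field.
by rewrite !mulr0n mulr0 subrr.
Qed.

Let ZA : Z^H *m A^H = A^H - 1%:M.
Proof.
rewrite -adjmxM AZ adjmxD adjmxN; congr (_ - _).
by apply/matrixP => i j; rewrite adjmxE !mxE rmorphMn rmorph1 eq_sym.
Qed.

Let row_displacement x : `|x| < 1 ->
  pick_row x *m (1%:M - x *: Z^H) = e^H - f x *: F^H.
Proof.
move=> x1; apply/rowP => j; rewrite mulmxBr mulmx1 -scalemxAr !mxE.
rewrite (bigD1 j) //= !mxE eqxx mulr1n big1 ?addr0; last first.
  by move=> i ij; rewrite !mxE eq_sym (negPf ij) mulr0n conjC0 mulr0.
rewrite rmorph1 /pick_kernel.
by have := one_sub_mul_conj_neq0 x1 (zD j) => ?; field.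
Qed.

(** The Stein equation of the Pick matrix: multiplying entry (i, j) by 1 - z_i conj(z_j) clears its
    denominator and leaves a matrix of rank at most two. *)
Let displacement : P - Z *m P *m Z^H = e *m e^H - F *m F^H.
Proof.
apply/row_matrixP => i; rewrite !linearB /= !row_mul.
have -> : row i e = 1%:M by apply/matrixP => a b; rewrite !mxE !ord1 eqxx.
have -> : row i F = (f (z i))%:M.
  by apply/matrixP => a b; rewrite !mxE !ord1 eqxx mulr1n.
have -> : row i Z = z i *: delta_mx 0 i.
  by apply/rowP => j; rewrite !mxE eqxx /= mulr_natr eq_sym.
rewrite mul1mx mul_scalar_mx -row_displacement // -!scalemxAl -rowE.
have -> : row i P = pick_row (z i) by apply/rowP => j; rewrite !mxE.
by rewrite mulmxBr mulmx1 -scalemxAr.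
Qed.

Let uPZA x : `|x| < 1 ->
  u x *m P *m A^H - x *: (u x *m P *m A^H - u x *m P) =
  (e^H - f x *: F^H) *m A^H.
Proof.
move=> x1; rewrite -row_displacement // uPE -mulmxA mulmxBl mul1mx -scalemxAl ZA.
by rewrite mulmxBr -scalemxAr mulmxBr mulmx1.
Qed.

Let uPZA_adj y : `|y| < 1 ->
  A *m P *m (u y)^H - y^* *: (A *m P *m (u y)^H - P *m (u y)^H) =
  A *m (e - (f y)^* *: F).
Proof.
move=> y1; have := congr1 (@adjmx _ _) (uPZA y1); move: (u y) => v.
rewrite !(adjmxD, adjmxN, adjmxZ, adjmxM, adjmxK) pick_matrix_herm.
by rewrite !mulmxA.
Qed.

(** Conjugating the Stein equation by the resolvent [A] cancels the quadratic term, because [A *m Z]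
    and its adjoint differ from [A] and its adjoint only by the identity. *)
Let APA : A *m (e *m e^H - F *m F^H) *m A^H = A *m P + P *m A^H - P.
Proof.
rewrite -displacement mulmxBr !mulmxA AZ mulmxBl -!mulmxA ZA.
rewrite !(mulmxBl, mulmxBr) mul1mx !mulmx1 !mul1mx.
apply/matrixP => i j; rewrite !(addmxE, oppmxE); ring.
Qed.

(** On the left stands an entry of the Schur complement of [P]. Expanding the right side leaves
    three combinations of the [e] and [F] terms, which [e1], [e2] and [e3] reduce by the Stein
    equation to the scalars [p], [q], [s]. *)
Lemma pick_kernel_schur x y : `|x| < 1 -> `|y| < 1 ->
  pick_kernel x y - (pick_row x *m invmx P *m (pick_row y)^H) 0 0 =
  (pick_den x * (pick_den y)^* - pick_num x * (pick_num y)^*) / (1 - x * y^*).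
Proof.
move=> x1 y1; have n0 := one_sub_mul_conj_neq0 x1 y1.
apply/(canRL (mulfK n0)); rewrite mulrBl /pick_kernel divfK //.
set s := (_ *m _) 0 0.
have conjE M : ((u y *m A *m M) 0 0)^* = (M^H *m A^H *m (u y)^H) 0 0.
  by rewrite -adjmxE !adjmxM mulmxA.
rewrite /pick_den /pick_num !rmorphB !rmorphM !rmorphB rmorph1 /= !conjE.
set p := (u x *m A *m P *m (u y)^H) 0 0; set q := (u x *m P *m A^H *m (u y)^H) 0 0.
have hs : s = (u x *m P *m (u y)^H) 0 0.
  rewrite /s uPE /u adjmxM adjmx_inv pick_matrix_herm -/P.
  by rewrite !mulmxA.
have e1 : (u x *m A *m e) 0 0 - (u x *m A *m F) 0 0 * (f y)^* = p - y^* * (p - s).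
  have := congr1 (fun M : 'M[C]_(n, 1) => (u x *m M) 0 0) (uPZA_adj y1).
  rewrite !mulmxBr -!scalemxAr !mulmxBr !mulmxA !(addmxE, oppmxE).
  rewrite ![(_ *: _ : 'M[C]_1) 0 0]mxE !(addmxE, oppmxE).
  by rewrite -/p -hs => ->; rewrite mulrC; ring.
have e2 : (e^H *m A^H *m (u y)^H) 0 0 - f x * (F^H *m A^H *m (u y)^H) 0 0
    = q - x * (q - s).
  have := congr1 (fun M : 'M[C]_(1, n) => (M *m (u y)^H) 0 0) (uPZA x1).
  rewrite !mulmxBl -!scalemxAl !mulmxBl !(addmxE, oppmxE).
  rewrite ![(_ *: _ : 'M[C]_1) 0 0]mxE !(addmxE, oppmxE).
  by rewrite -/q -hs => ->; ring.
have e3 : (u x *m A *m e) 0 0 * (e^H *m A^H *m (u y)^H) 0 0 -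
    (u x *m A *m F) 0 0 * (F^H *m A^H *m (u y)^H) 0 0 = p + q - s.
  have mul11 (M N : 'M[C]_1) : M 0 0 * N 0 0 = (M *m N) 0 0.
    by rewrite mxE big_ord1.
  have := congr1 (fun M : 'M[C]_n => (u x *m M *m (u y)^H) 0 0) APA.
  rewrite !mul11 !(mulmxBr, mulmxBl, mulmxDr, mulmxDl, mulmxN, mulNmx) !mulmxA.
  rewrite !(addmxE, oppmxE).
  by rewrite -/p -/q -hs.
have -> (a b c d g h w : C) : (1 - (1 - x) * a) * (1 - (1 - w) * b) -
   (g - (1 - x) * c) * (h - (1 - w) * d) = (1 - g * h) - (1 - x) * (a - c * h)
   - (1 - w) * (b - g * d) + (1 - x) * (1 - w) * (a * b - c * d) by ring.
rewrite e1 e2 e3; ring.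
Qed.

(** If both vanish, the Stein equation collapses to u = (1 - x) u A, that is u_j (x - z_j) = 0 for
    all j. Off the nodes this gives u = 0, and then the denominator is 1. *)
Lemma pick_num_den_neq0 x : `|x| < 1 -> (forall i, x != z i) ->
  ~ (pick_den x = 0 /\ pick_num x = 0).
Proof.
move=> x1 xz [d0 n0].
suff u0 : u x = 0.
  move: d0; rewrite /pick_den u0 !mul0mx mxE mulr0 subr0 => /eqP.
  by rewrite oner_eq0.
have uA : u x = (1 - x) *: (u x *m A).
  apply: (can_inj (mulmxK uP)); rewrite -/P -scalemxAl.
  have he : (1 - x) *: (u x *m A *m e) = 1%:M.
    rewrite [_ *m _]mx11_scalar scale_scalar_mx; congr (_%:M).
    by apply/esym/eqP; rewrite -subr_eq0; apply/eqP.
  have hF : (1 - x) *: (u x *m A *m F) = (f x)%:M.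
    rewrite [_ *m _]mx11_scalar scale_scalar_mx; congr (_%:M).
    by apply/esym/eqP; rewrite -subr_eq0; apply/eqP.
  have h : (e^H - f x *: F^H) *m A^H =
           (1 - x) *: (u x *m (A *m (e *m e^H - F *m F^H) *m A^H)).
    rewrite !mulmxA scalemxAl; congr (_ *m _).
    rewrite mulmxBr scalerBr !mulmxA (scalemxAl _ (u x *m A *m e)) he mul1mx.
    by rewrite (scalemxAl _ (u x *m A *m F)) hF mul_scalar_mx.
  move: h; rewrite -uPZA // APA mulmxBr mulmxDr !mulmxA => h.
  apply/rowP => j; have := congr1 (fun M : 'rV_n => M 0 j) h.
  have sE (c : C) (M : 'rV[C]_n) : (c *: M) 0 j = c * M 0 j by rewrite mxE.
  rewrite !(addmxE, oppmxE, sE) => h'.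
  apply/eqP; rewrite -subr_eq0; apply/eqP.
  move/eqP: h'; rewrite -subr_eq0 => /eqP h'.
  have x0 := one_sub_neq0 x1.
  rewrite -[RHS]h'; ring.
move: (u x) uA => w uA; apply/rowP => j; rewrite [RHS]mxE.
have := congr1 (fun M : 'rV_n => M 0 j) uA.
rewrite mxE mul_mx_diag !mxE; move: (w 0 j) => a h.
have z0 := one_sub_neq0 (zD j).
have : a * (x - z j) = 0.
  move/(congr1 (fun t => t * (1 - z j))): h.
  have -> : (1 - x) * (a / (1 - z j)) * (1 - z j) = (1 - x) * a by field.
  move=> h'; have -> : a * (x - z j) = a * (1 - z j) - (1 - x) * a by ring.
  by rewrite h' subrr.
by move/eqP; rewrite mulf_eq0 subr_eq0 (negPf (xz j)) orbF => /eqP.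
Qed.

End PickKernel.

End Inertia.

(** * Power series *)

Section Modulus.
Variable R : realType.
Local Notation C := R[i].

(* The library's modulus is valued in [R[i]], whose order is only partial. *)
Definition modulus (z : C) : R := complex.Re `|z|.

Lemma normE (z : C) : `|z| = (modulus z)%:C%C.
Proof. by rewrite /modulus normc_def. Qed.

Lemma norm_lt1 (w : C) : (`|w| < 1) = (modulus w < 1).
Proof. by rewrite normE -(rmorph1 (real_complex R)) ltcR. Qed.

Lemma modulus_ge0 z : 0 <= modulus z.
Proof. by rewrite -lecR -normE normr_ge0. Qed.

Lemma modulusM x y : modulus (x * y) = modulus x * modulus y.
Proof.
by apply: (@complexI R); rewrite -normE normrM !normE -rmorphM.
Qed.

Lemma modulusD x y : modulus (x + y) <= modulus x + modulus y.
Proof. by rewrite -lecR rmorphD -!normE /= ler_normD. Qed.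

Lemma modulusN x : modulus (- x) = modulus x.
Proof. by rewrite /modulus normrN. Qed.

Lemma modulusB x y : modulus (x - y) = modulus (y - x).
Proof. by rewrite /modulus distrC. Qed.

Lemma modulus0 : modulus 0 = 0.
Proof. by rewrite /modulus normr0. Qed.

Lemma modulus1 : modulus 1 = 1.
Proof. by rewrite /modulus normr1. Qed.

Lemma modulus_gt0 x : (0 < modulus x) = (x != 0).
Proof. by rewrite -ltcR -normE normr_gt0. Qed.

Lemma modulusX x n : modulus (x ^+ n) = modulus x ^+ n.
Proof. by elim: n => [|n IH]; rewrite ?expr0 ?modulus1 // !exprS modulusM IH. Qed.

Lemma modulusV x : modulus x^-1 = (modulus x)^-1.
Proof.
by apply: (@complexI R); rewrite fmorphV -!normE normfV.
Qed.

Lemma modulus_real (x : R) : modulus x%:C%C = `|x|.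
Proof. by rewrite /modulus normc_def /= expr0n addr0 sqrtr_sqr. Qed.

Lemma modulus_i : modulus 'i%C = 1.
Proof. by rewrite /modulus normc_def /= expr0n add0r expr1n sqrtr1. Qed.

Lemma modulus_conj (x : C) : modulus x^* = modulus x.
Proof. by rewrite /modulus norm_conjC. Qed.

Lemma modulus_sum I (r : seq I) (F : I -> C) :
  modulus (\sum_(i <- r) F i) <= \sum_(i <- r) modulus (F i).
Proof.
elim: r => [|i r IH]; rewrite ?big_nil ?modulus0 // !big_cons.
by apply: (le_trans (modulusD _ _)); rewrite lerD2l.
Qed.

End Modulus.

Section PowerSeries.
Variable R : realType.
Local Notation C := R[i].
Local Notation modulus := (@modulus R).
Implicit Types (a b : nat -> C) (F G h : C -> C) (r s : R).

Definition psum a t N : C := \sum_(0 <= k < N) a k * t ^+ k.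

(** Pointwise convergence is all that [analytic_on] provides; uniform estimates are recovered in
    [ps_bound]. *)
Definition is_ps r a F : Prop := 0 < r /\ forall t, modulus t < r ->
  forall e, 0 < e -> exists N0, forall N, (N0 <= N)%N -> modulus (psum a t N - F t) < e.

Lemma ps_at0 r a F : is_ps r a F -> F 0 = a 0%N.
Proof.
case=> r0 cF; apply/eqP; rewrite -subr_eq0 -[_ == _]negbK -modulus_gt0.
apply/negP => /(cF 0) []; first by rewrite modulus0.
move=> N0 /(_ N0.+1 (leqnSn _)); rewrite /psum big_nat_recl // expr0 mulr1.
rewrite big1 ?addr0 => [|i _]; last by rewrite exprS mul0r mulr0.
by rewrite modulusB ltxx.
Qed.

Lemma ps_le r s a F : 0 < s -> s <= r -> is_ps r a F -> is_ps s a F.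
Proof. by move=> s0 sr [_ cF]; split=> // t ts; apply: cF; apply: lt_le_trans sr. Qed.

Lemma ps_lin r a b F G c d : is_ps r a F -> is_ps r b G ->
  is_ps r (fun k => c * a k + d * b k) (fun t => c * F t + d * G t).
Proof.
move=> [r0 cF] [_ cG]; split=> // t tr e e0.
pose m := modulus c + modulus d + 1.
have m0 : 0 < m by rewrite /m; have := modulus_ge0 c; have := modulus_ge0 d; lra.
have em : 0 < e / m by rewrite divr_gt0.
have [N1 H1] := cF t tr _ em; have [N2 H2] := cG t tr _ em.
exists (maxn N1 N2) => N; rewrite geq_max => /andP[/H1 {}H1 /H2 {}H2].
have -> : psum (fun k => c * a k + d * b k) t N =
    c * psum a t N + d * psum b t N.
  rewrite /psum !mulr_sumr -big_split /=; apply: eq_bigr => k _; ring.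
have -> : c * psum a t N + d * psum b t N - (c * F t + d * G t) =
  c * (psum a t N - F t) + d * (psum b t N - G t) by ring.
apply: (le_lt_trans (modulusD _ _)); rewrite !modulusM.
apply: (@le_lt_trans _ _ ((modulus c + modulus d) * (e / m))).
  by rewrite mulrDl; apply: lerD; apply: ler_wpM2l; rewrite ?modulus_ge0 // ltW.
rewrite -[X in _ < X](divfK (lt0r_neq0 m0)) mulrC ltr_pM2l // /m; lra.
Qed.

Lemma ps_const r c : 0 < r -> is_ps r (fun k => if k is 0 then c else 0) (fun=> c).
Proof.
move=> r0; split=> // t _ e e0; exists 1%N => -[//|N] _.
rewrite /psum big_nat_recl // expr0 mulr1 big1 ?addr0 => [|i _].
  by rewrite subrr modulus0.
by rewrite mul0r.
Qed.

Lemma ps_shift r a F : is_ps r a F ->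
  is_ps r (fun k => if k is k'.+1 then a k' else 0) (fun t => t * F t).
Proof.
move=> [r0 cF]; split=> // t tr e e0.
have em : 0 < e / (modulus t + 1).
  by rewrite divr_gt0 //; have := modulus_ge0 t; lra.
have [N0 H] := cF t tr _ em; exists N0.+1 => -[//|N]; rewrite ltnS => /H {}H.
rewrite /psum big_nat_recl // mul0r add0r.
have -> : \sum_(0 <= i < N) a i * t ^+ i.+1 = t * psum a t N.
  by rewrite /psum mulr_sumr; apply: eq_bigr => k _; rewrite exprS; ring.
rewrite -mulrBr modulusM.
have m0 : 0 < modulus t + 1 by have := modulus_ge0 t; lra.
apply: (@le_lt_trans _ _ (modulus t * (e / (modulus t + 1)))).
  by apply: ler_wpM2l; rewrite ?modulus_ge0 // ltW.
rewrite -[X in _ < X](divfK (lt0r_neq0 m0)) mulrC ltr_pM2l //; lra.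
Qed.

Lemma ps_mul_lin r a F c d : is_ps r a F ->
  exists2 b, b 0%N = c * a 0%N & is_ps r b (fun t => (c + d * t) * F t).
Proof.
move=> pF; exists (fun k => c * a k + d * (if k is k'.+1 then a k' else 0)).
  by rewrite mulr0 addr0.
have := ps_lin c d pF (ps_shift pF).
by rewrite (_ : (fun t => (c + d * t) * F t) = (fun t => c * F t + d * (t * F t))) //;
  apply/funext => t; ring.
Qed.

Lemma ps_div r a F : is_ps r a F -> a 0%N = 0 ->
  exists2 G, is_ps r (fun k => a k.+1) G & forall t, F t = t * G t.
Proof.
move=> pF a0; have F0 := ps_at0 pF; case: pF => r0 cF.
exists (fun t => if t == 0 then a 1%N else F t / t); last first.
  by move=> t; case: eqVneq => [->|t0]; rewrite ?F0 ?a0 ?mul0r // mulrCA divff ?mulr1.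
split=> // t tr e e0; case: eqVneq => [->|t0].
  exists 1%N => -[//|N] _; rewrite /psum big_nat_recl // expr0 mulr1.
  rewrite big1 ?addr0 => [|i _]; first by rewrite subrr modulus0.
  by rewrite exprS mul0r mulr0.
have t0' : 0 < modulus t by rewrite modulus_gt0.
have [N0 H] := cF t tr _ (mulr_gt0 t0' e0); exists N0 => N /leqW/H {H}.
have -> : psum a t N.+1 = t * psum (fun k => a k.+1) t N.
  rewrite /psum big_nat_recl // a0 mul0r add0r mulr_sumr.
  by apply: eq_bigr => k _; rewrite exprS; ring.
have {1}-> : F t = t * (F t / t) by field.
by rewrite -mulrBr modulusM ltr_pM2l.
Qed.

Lemma geometric_sum_le2 (q : R) N : 0 <= q -> q <= 1 / 2 -> \sum_(0 <= k < N) q ^+ k <= 2.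
Proof.
move=> q0 q1; elim: N => [|N IH]; first by rewrite big_nil.
rewrite big_nat_recl // expr0.
have -> : \sum_(0 <= i < N) q ^+ i.+1 = q * \sum_(0 <= i < N) q ^+ i.
  by rewrite mulr_sumr; apply: eq_bigr => k _; rewrite exprS.
have : 0 <= \sum_(0 <= i < N) q ^+ i by apply: sumr_ge0 => i _; rewrite exprn_ge0.
nra.
Qed.

Lemma finite_bound (u : nat -> R) N : exists B, forall k, (k < N)%N -> u k <= B.
Proof.
elim: N => [|N [B HB]]; first by exists 0.
exists (Num.max B (u N)) => k; rewrite ltnS leq_eqVlt => /predU1P[->|/HB h].
  by rewrite le_max lexx orbT.
by rewrite le_max h.
Qed.

(** Convergence at r/2 bounds a_k (r/2)^k, and for |t| < r/4 the series is then dominated by a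
    geometric one of ratio at most 1/2. *)
Lemma ps_bound r a F : is_ps r a F ->
  exists2 B, 0 < B & forall t, modulus t < r / 4 -> modulus (F t) <= B.
Proof.
case=> r0 cF; have r2 : modulus (r / 2)%:C%C < r.
  by rewrite modulus_real ger0_norm; lra.
have [N0 H0] := cF _ r2 1 ltr01.
have [B0 HB0] := finite_bound (fun k => modulus (a k) * (r / 2) ^+ k) N0.
(* The 2 covers late terms: each is the difference of two partial sums within 1 of the limit. *)
pose B := Num.max B0 2.
have HB k : modulus (a k) * (r / 2) ^+ k <= B.
  have [/HB0 h|h] := ltnP k N0; first by rewrite le_max h.
  rewrite le_max; apply/orP; right.
  have := H0 _ h; have := H0 _ (leqW h); set p1 := psum _ _ k.+1; set p0 := psum _ _ k.
  have -> : modulus (a k) * (r / 2) ^+ k = modulus (p1 - p0).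
    rewrite /p1 /psum big_nat_recr //= -/(psum _ _ _) -/p0 addrC addrK modulusM.
    by rewrite modulusX modulus_real ger0_norm //; lra.
  have -> : p1 - p0 = (p1 - F (r / 2)%:C%C) - (p0 - F (r / 2)%:C%C) by ring.
  have := modulusD (p1 - F (r / 2)%:C%C) (- (p0 - F (r / 2)%:C%C)).
  by rewrite modulusN; lra.
have B2 : 2 <= B by rewrite /B le_max lexx orbT.
exists (2 * B + 1) => [|t tr]; first lra.
have tr' : modulus t < r by lra.
have [N H] := cF t tr' 1 ltr01; have {H} := H N (leqnn _).
have : modulus (psum a t N) <= 2 * B.
  apply: (le_trans (modulus_sum _ _)).
  pose q := modulus t / (r / 2).
  apply: (@le_trans _ _ (\sum_(0 <= k < N) B * q ^+ k)).
    apply: ler_sum => k _; rewrite modulusM modulusX.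
    have -> : modulus t ^+ k = (r / 2) ^+ k * q ^+ k.
      by rewrite -exprMn /q; congr (_ ^+ _); field; lra.
    rewrite mulrA ler_wpM2r // exprn_ge0 // /q divr_ge0 ?modulus_ge0 //; lra.
  rewrite -mulr_sumr mulrC ler_pM2r; last lra.
  apply: geometric_sum_le2; first by rewrite /q divr_ge0 ?modulus_ge0 //; lra.
  rewrite /q ler_pdivrMr; lra.
have := modulusD (psum a t N) (- (psum a t N - F t)).
rewrite modulusN (_ : psum a t N - (psum a t N - F t) = F t); last ring.
lra.
Qed.

(** The difference F - a_0 is t times a power series, and that series is bounded near 0. *)
Lemma ps_lipschitz r a F : is_ps r a F -> exists K d, [/\ 0 < K, 0 < d &
  forall t, modulus t < d -> modulus (F t - a 0%N) <= K * modulus t].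
Proof.
move=> pF; have r0 := pF.1.
have := ps_lin 1 (- a 0%N) pF (ps_const 1 r0) => /ps_div[|G pG FG].
  by ring.
have [B B0 HB] := ps_bound pG; exists B, (r / 4); split=> //; first lra.
move=> t /HB h; have := FG t; rewrite mulr1 mul1r => ->.
by rewrite modulusM mulrC ler_wpM2r // modulus_ge0.
Qed.

Lemma ps_order r a F : is_ps r a F -> (forall t, modulus t < r -> F t = 0) \/
  exists k b G, [/\ is_ps r b G, b 0%N != 0 & forall t, F t = t ^+ k * G t].
Proof.
move=> pF; have [az|] := pselect (forall k, a k = 0).
  left=> t tr; apply/eqP; rewrite -[_ == _]negbK -modulus_gt0; apply/negP => Ft.
  have [N /(_ _ (leqnn _))] := pF.2 _ tr _ Ft.
  rewrite /psum big1 ?sub0r ?modulusN ?ltxx // => i _.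
  by rewrite az mul0r.
move=> /existsNP[k /eqP ak]; right; elim: k a F pF ak => [|k IH] a F pF ak.
  by exists 0%N, a, F; split=> // t; rewrite expr0 mul1r.
have [a0|a0] := eqVneq (a 0%N) 0; last first.
  by exists 0%N, a, F; split=> // t; rewrite expr0 mul1r.
have [G pG FG] := ps_div pF a0; have [l [b [H [pH bH GH]]]] := IH _ _ pG ak.
by exists l.+1, b, H; split=> // t; rewrite FG GH exprS mulrA.
Qed.

(* Quotients of power series instead of power series: this class is closed
   under the Schur transform without dividing series. *)
Definition analytic_at h z0 : Prop := exists r a b N M, [/\ is_ps r a N, is_ps r b M,
  b 0%N != 0 & forall t, modulus t < r -> N t = h (z0 + t) * M t].

Lemma analytic_at_diff h z0 : analytic_at h z0 ->
  exists r b E M, [/\ is_ps r b M, b 0%N != 0,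
   (exists2 e, is_ps r e E & e 0%N = 0) &
   forall t, modulus t < r -> E t = (h (z0 + t) - h z0) * M t].
Proof.
move=> [r [a [b [N [M [pN pM b0 H]]]]]].
have r0 := pN.1; have m0 : modulus 0 < r by rewrite modulus0.
exists r, b, (fun t => 1 * N t + (- h z0) * M t), M; split=> //; last first.
  by move=> t tr; rewrite H //; ring.
exists (fun k => 1 * a k + (- h z0) * b k); first exact: ps_lin.
by rewrite -(ps_at0 pN) -(ps_at0 pM) H // addr0; ring.
Qed.

Lemma ps_unit_bound r b M : is_ps r b M -> b 0%N != 0 -> exists2 d, 0 < d &
  forall t, modulus t < d -> modulus (b 0%N) / 2 <= modulus (M t).
Proof.
move=> pM; rewrite -modulus_gt0 => b0; have [K [d [K0 d0 H]]] := ps_lipschitz pM.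
exists (Num.min d (modulus (b 0%N) / 2 / K)).
  by rewrite lt_min d0 !divr_gt0.
move=> t; rewrite lt_min => /andP[/H h1]; rewrite ltr_pdivlMr // => h2.
have := modulusD (M t) (- (M t - b 0%N)); rewrite modulusN.
rewrite (_ : M t - _ = b 0%N); last ring.
rewrite mulrC in h2; lra.
Qed.

Lemma analytic_at_continuous h z0 : analytic_at h z0 -> forall e, 0 < e ->
  exists2 d, 0 < d & forall t, modulus t < d -> modulus (h (z0 + t) - h z0) < e.
Proof.
move=> /analytic_at_diff[r [b [E [M [pM b0 [c pE c0] H]]]]] e e0.
have [d1 d10 H1] := ps_unit_bound pM b0.
have [K [d2 [K0 d20 H2]]] := ps_lipschitz pE.
have bm : 0 < modulus (b 0%N) by rewrite modulus_gt0.
exists (Num.min (Num.min r d1) (Num.min d2 (e * (modulus (b 0%N) / 2) / K))).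
  by rewrite !lt_min d10 d20 pM.1 !(mulr_gt0, divr_gt0, invr_gt0).
move=> t; rewrite !lt_min => /andP[/andP[/H {}H /H1 {}H1] /andP[/H2 {}H2]].
rewrite ltr_pdivlMr // => h3; rewrite c0 subr0 H modulusM in H2.
have := modulus_ge0 (h (z0 + t) - h z0).
rewrite ltNge; apply: contraTN => h4; rewrite -ltNge.
have : e * (modulus (b 0%N) / 2) <= modulus (h (z0 + t) - h z0) * modulus (M t).
  by apply: ler_pM => //; [exact: ltW|lra].
rewrite mulrC in h3; lra.
Qed.

(* At a nonzero value [c], write [h - c = t^k G / M] with [G], [M] nonzero at 0
   and move along a [k]-th root that makes [t^k G / (c M)] positive. *)
Lemma analytic_at_max h z0 : analytic_at h z0 -> h z0 != 0 ->
  (exists2 d, 0 < d & forall t, modulus t < d -> h (z0 + t) = h z0) \/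
  (forall d, 0 < d -> exists2 t, modulus t < d & modulus (h z0) < modulus (h (z0 + t))).
Proof.
move=> /analytic_at_diff[r [b [E [M [pM b0 [e pE e0] H]]]]]; set c := h z0 => hc.
have [d1 d10 H1] := ps_unit_bound pM b0; have r0 := pM.1.
have bm : 0 < modulus (b 0%N) by rewrite modulus_gt0.
have M0 t : modulus t < d1 -> M t != 0.
  by move=> /H1 h1; rewrite -modulus_gt0; lra.
have [E0|[k [g [G [pG g0 EG]]]]] := ps_order pE.
  left; exists (Num.min r d1); first by rewrite lt_min r0.
  move=> t; rewrite lt_min => /andP[tr /M0 Mt]; apply/eqP; rewrite -subr_eq0.
  by have /esym/eqP := H t tr; rewrite E0 // mulf_eq0 (negPf Mt) orbF.
right=> d d0.
have k0 : (0 < k)%N.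
  case: k EG => // EG; have := EG 0; rewrite (ps_at0 pE) e0 expr0 mul1r (ps_at0 pG).
  by move/esym/eqP; rewrite (negPf g0).
(* With this root, t^k G(t) and tau^k c M(t) agree to leading order for t = tau w; their difference
   is tau^k [q], with [q] vanishing to first order at 0. *)
pose w := k.-root (c * b 0%N / g 0%N).
have wk : w ^+ k * g 0%N = c * b 0%N by rewrite rootCK // divfK.
have [K [d2 [K0 d20 H2]]] := ps_lipschitz (ps_lin (w ^+ k) (- c) pG pM).
have cm : 0 < modulus c by rewrite modulus_gt0.
pose m := Num.min (Num.min d d1)
  (Num.min (Num.min r d2) (modulus c * (modulus (b 0%N) / 2) / K)).
have m0 : 0 < m by rewrite !lt_min d0 d10 r0 d20 !(mulr_gt0, divr_gt0, invr_gt0).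
have w0 : 0 < modulus w.
  rewrite modulus_gt0; apply/eqP => w0; move/esym/eqP: wk.
  by rewrite w0 expr0n gtn_eqF // mul0r mulf_eq0 (negPf b0) (negPf hc).
pose tau := m / (2 * modulus w).
have tau0 : 0 < tau by rewrite divr_gt0 // mulr_gt0.
pose t : C := tau%:C%C * w.
have tm : modulus t < m.
  rewrite modulusM modulus_real gtr0_norm // (_ : tau * _ = m / 2); first lra.
  by rewrite /tau; field; exact: lt0r_neq0.
have := tm; rewrite !lt_min => /andP[/andP[td /H1 Mt] /andP[/andP[/H Et /H2 qt]]].
rewrite ltr_pdivlMr // => tK; exists t => //.
have ck : w ^+ k * g 0%N + - c * b 0%N = 0 by rewrite wk; ring.
rewrite ck subr0 in qt; set q := _ + _ in qt.
(* The gain tau^k c M(t) outweighs the error tau^k [q], as the last term in the minimum [m] makes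
   |q| < |c M(t)|. *)
have key : h (z0 + t) * M t = (1 + (tau ^+ k)%:C%C) * (c * M t) + (tau ^+ k)%:C%C * q.
  have -> : h (z0 + t) * M t = E t + c * M t by rewrite Et -/c; ring.
  rewrite EG /q /t exprMn rmorphXn /=; ring.
have Mp : 0 < modulus (M t) by lra.
rewrite -(ltr_pM2r Mp) -!modulusM key.
set s := tau ^+ k in key *; have s0 : 0 < s by rewrite exprn_gt0.
have := modulusD ((1 + s%:C%C) * (c * M t) + s%:C%C * q) (- (s%:C%C * q)).
rewrite modulusN addrK [modulus ((1 + _) * _)]modulusM [modulus (_ * q)]modulusM.
have -> : 1 + s%:C%C = (1 + s)%:C%C :> C by rewrite rmorphD rmorph1.
rewrite !modulus_real !gtr0_norm //; last lra.
rewrite [modulus (c * M t)]modulusM => h1.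
have h2 : modulus c * (modulus (b 0%N) / 2) <= modulus c * modulus (M t).
  by rewrite ler_pM2l.
have h3 : modulus q < modulus c * modulus (M t) by rewrite mulrC in tK; lra.
have h4 : s * modulus q < s * (modulus c * modulus (M t)) by rewrite ltr_pM2l.
lra.
Qed.

End PowerSeries.

(** * The maximum principle *)

Section MaximumPrinciple.
Variable R : realType.
Local Notation C := R[i].
Local Notation modulus := (@modulus R).

Lemma Re_le_modulus (z : C) : `|complex.Re z| <= modulus z.
Proof. by rewrite -lecR -normE normc_ge_Re. Qed.

Lemma Im_le_modulus (z : C) : `|complex.Im z| <= modulus z.
Proof.
rewrite -lecR -normE normc_def lecR -sqrtr_sqr ler_wsqrtr // lerDr sqr_ge0 //.
Qed.

Lemma modulus_le_ReIm (z : C) : modulus z <= `|complex.Re z| + `|complex.Im z|.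
Proof.
have -> : z = (complex.Re z)%:C%C + 'i%C * (complex.Im z)%:C%C.
  exact: complexE.
apply: (le_trans (modulusD _ _)); rewrite modulusM !modulus_real.
rewrite modulus_i mul1r; case: z => x y /=.
by rewrite !(mul0r, mul1r, mulr0, addr0, add0r, subr0).
Qed.

(** Compactness is imported from the real square [-r, r]^2 through real and imaginary parts. Stated
    for filters, it serves both for maximisers and for cluster values of functions. *)
Lemma disk_cluster (F : set_system C) r : ProperFilter F ->
  F [set z | modulus z <= r] -> exists c, forall (A : set C) e, F A -> 0 < e ->
    exists2 z, A z & modulus (z - c) < e.
Proof.
move=> PF Fr; pose phi (z : C) : R * R := (complex.Re z, complex.Im z).
have cK := compact_setX (@segment_compact R (- r) r) (@segment_compact R (- r) r).
have : F (phi @^-1` (`[- r, r] `*` `[- r, r])).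
  apply: filterS Fr => z /= zr; rewrite /= !in_itv /= -!ler_norml.
  split; [exact: le_trans (Re_le_modulus _) zr|exact: le_trans (Im_le_modulus _) zr].
move=> /(cK (phi @ F))[[x y] [_ cl]]; exists (x +i* y)%C => A e FA e0.
have [] := cl (phi @` A) (ball (x, y) (e / 2)).
- by apply: (@filterS _ F _ A) FA => z Az; exists z.
- by apply: nbhsx_ballx; rewrite divr_gt0.
move=> _ [[[a b] Az <-] [/= ]]; rewrite /ball /= => h1 h2.
exists (a +i* b)%C => //; apply: (le_lt_trans (modulus_le_ReIm _)) => /=.
by rewrite -[a - x]opprB -[b - y]opprB !normrN; lra.
Qed.

(** Superlevel sets of [phi] generate a proper filter, and any cluster point of it is a
    maximiser. *)
Lemma disk_max (P : set C) (phi : C -> R) r : P !=set0 ->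
  (forall z, P z -> modulus z <= r) ->
  (forall c, (forall e, 0 < e -> exists2 z, P z & modulus (z - c) < e) -> P c) ->
  (forall c, P c -> forall e, 0 < e -> exists2 d, 0 < d &
     forall z, P z -> modulus (z - c) < d -> `|phi z - phi c| < e) ->
  exists2 c, P c & forall z, P z -> phi z <= phi c.
Proof.
move=> [p0 Pp0] Pr Pcl Pcont.
pose B w := [set z | P z /\ phi w <= phi z].
have FF : ProperFilter (filter_from P B).
  apply: filter_from_proper; last by move=> w Pw; exists w.
  apply: filter_from_filter; first by exists p0.
  move=> v w Pv Pw; have [vw|wv] := leP (phi v) (phi w).
    by exists w => // z [Pz wz]; split; split=> //; apply: le_trans wz.
  by exists v => // z [Pz vz]; split; split=> //; apply: le_trans vz; exact: ltW.
have [|c cl] := @disk_cluster _ r FF.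
  by exists p0 => // z [Pz _]; exact: Pr.
have FB w : P w -> filter_from P B (B w) by move=> Pw; exists w.
have Pc : P c.
  by apply: Pcl => e e0; have [z [Pz _] zc] := cl _ _ (FB _ Pp0) e0; exists z.
exists c => // w Pw; rewrite leNgt; apply/negP => cw.
have [|d d0 Hd] := Pcont c Pc (phi w - phi c); first lra.
have [z [Pz wz] /(Hd _ Pz)] := cl _ _ (FB _ Pw) d0.
rewrite ltr_norml; lra.
Qed.

Definition disk_analytic (h : C -> C) := forall z, modulus z < 1 -> analytic_at h z.

(* Among the points where [|h|] is maximal take one of largest modulus; if it
   were interior then [h] would be constant near it, contradicting the choice. *)
Lemma max_principle h m rho : disk_analytic h -> 0 < rho -> rho < 1 -> 0 <= m ->
  (forall z, rho <= modulus z -> modulus z < 1 -> modulus (h z) <= m) ->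
  forall z, modulus z < 1 -> modulus (h z) <= m.
Proof.
move=> an r0 r1 m0 bd z z1; rewrite leNgt; apply/negP => hz.
have cont c : modulus c <= rho -> forall e, 0 < e -> exists2 d, 0 < d &
    forall z, modulus (z - c) < d -> `|modulus (h z) - modulus (h c)| < e.
  move=> cr e e0; have c1 : modulus c < 1 by lra.
  have [d d0 Hd] := analytic_at_continuous (an c c1) e0.
  exists d => // w /Hd; rewrite (addrC c) subrK => hw.
  have := modulusD (h w - h c) (h c); have := modulusD (h c - h w) (h w).
  by rewrite !subrK (modulusB (h c)) ltr_norml; lra.
have disk_closed c :
    (forall e, 0 < e -> exists2 z, modulus z <= rho & modulus (z - c) < e) ->
    modulus c <= rho.
  move=> H; rewrite leNgt; apply/negP => rc.
  have [|w wr wc] := H (modulus c - rho); first lra.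
  by have := modulusD (c - w) w; rewrite subrK modulusB; lra.
have zr : modulus z <= rho.
  by rewrite leNgt; apply/negP => zr; have := bd z (ltW zr) z1; lra.
have [||||c cr cmax] := @disk_max [set w | modulus w <= rho] (fun w => modulus (h w)) rho.
- by exists z.
- by [].
- exact: disk_closed.
- by move=> c /cont H e /H[d d0 Hd]; exists d => // w _; exact: Hd.
have [||||p [/= pr pc] pmax] := @disk_max [set w | modulus w <= rho /\
    modulus (h w) = modulus (h c)] modulus rho.
- by exists c.
- by move=> w [].
- move=> q Hq; have qr : modulus q <= rho.
    by apply: disk_closed => e /Hq[w [] *]; exists w.
  split=> //; apply/eqP; rewrite -subr_eq0 -normr_eq0 -[_ == _]negbK -normr_gt0 normr_id.
  apply/negP => /(cont q qr)[d /Hq[w [_ hw] wd] /(_ w wd)].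
  by rewrite hw distrC ltxx.
- move=> q _ e e0; exists e => // w _ hw.
  have := modulusD (w - q) q; have := modulusD (q - w) w.
  by rewrite !subrK (modulusB q) ltr_norml; lra.
have hp : m < modulus (h p).
  by rewrite pc; apply: lt_le_trans hz _; exact: cmax.
have pr' : modulus p < rho.
  rewrite lt_neqAle pr andbT; apply/eqP => e; have p1 : modulus p < 1 by lra.
  by have := bd p; rewrite e lexx => /(_ isT r1); lra.
have hp0 : h p != 0 by rewrite -modulus_gt0; lra.
have p1 : modulus p < 1 by lra.
have [[d d0 Hd]|Hd] := analytic_at_max (an p p1) hp0; last first.
  have [|t td] := Hd (rho - modulus p); first lra.
  rewrite pc ltNge cmax //=; apply: (le_trans (modulusD _ _)); lra.
(* An outward step short enough to stay both where [h] is constant and in the disk of radius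
   [rho]. *)
pose s := Num.min (d / 2) ((rho - modulus p) / 2).
have s0 : 0 < s by rewrite lt_min; apply/andP; split; lra.
have [sd sr] : s <= d / 2 /\ s <= (rho - modulus p) / 2.
  by split; rewrite ge_min lexx ?orbT.
(* The radial unit direction at [p]; at the origin any direction is outward, and 1 is taken. *)
pose u : C := if p == 0 then 1 else p / (modulus p)%:C%C.
have u1 : modulus u = 1.
  rewrite /u; case: eqVneq => [_|p0]; first exact: modulus1.
  rewrite modulusM modulusV modulus_real ger0_norm ?modulus_ge0 // divff //.
  by rewrite gt_eqF // modulus_gt0.
have pu : p = (modulus p)%:C%C * u.
  rewrite /u; case: eqVneq => [->|p0]; first by rewrite modulus0 mul0r.
  rewrite mulrC divfK //; apply/eqP => /(@complexI R) e.
  by move: p0; rewrite -modulus_gt0 e ltxx.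
have st : modulus (s%:C%C * u) = s by rewrite modulusM u1 mulr1 modulus_real gtr0_norm.
have pm : modulus (p + s%:C%C * u) = modulus p + s.
  rewrite {1}pu -mulrDl -rmorphD modulusM u1 mulr1 modulus_real ger0_norm //.
  by have := modulus_ge0 p; lra.
have : modulus (p + s%:C%C * u) <= modulus p.
  by apply: pmax; split; [rewrite pm; lra|rewrite Hd // st; lra].
rewrite pm; lra.
Qed.

End MaximumPrinciple.

(** * Schur's algorithm *)

Section SchurAlgorithm.
Variable R : realType.
Local Notation C := R[i].
Local Notation modulus := (@modulus R).
Implicit Types (h g : C -> C).

Lemma sqr_modulus (z : C) : (modulus z ^+ 2)%:C%C = z * z^*.
Proof. by rewrite rmorphXn /= -normE normCK. Qed.

Lemma modulus_mobius (x y : C) : modulus (1 - x^* * y) ^+ 2 =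
  modulus (y - x) ^+ 2 + (1 - modulus x ^+ 2) * (1 - modulus y ^+ 2).
Proof.
have morphE (u v w : R) : (u + (1 - v) * (1 - w))%:C%C =
    u%:C%C + (1 - v%:C%C) * (1 - w%:C%C) :> C.
  by rewrite !(rmorphD, rmorphM, rmorphN, rmorph1).
apply: (@complexI R); rewrite morphE !sqr_modulus.
rewrite !(rmorphB Num.conj) rmorphM rmorph1 /= conjCK; ring.
Qed.

Lemma one_sub_conj_neq0 (x y : C) : modulus x < 1 -> modulus y <= 1 ->
  1 - x^* * y != 0.
Proof.
move=> x1 y1; rewrite subr_eq0; apply/eqP => e.
have := congr1 modulus e; rewrite modulus1 modulusM modulus_conj.
have := modulus_ge0 x; have := modulus_ge0 y; nra.
Qed.

Lemma disk_analytic_scale h c : disk_analytic h ->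
  disk_analytic (fun z => c * h z).
Proof.
move=> an z /an [r [a [b [N [M [pN pM b0 H]]]]]].
exists r, (fun k => c * a k + 0 * b k), b, (fun t => c * N t + 0 * M t), M.
by split=> //; [exact: ps_lin|move=> t /H ->; ring].
Qed.

(** The transform is a disk automorphism applied to h(z), hence of modulus at most 1, divided by the
    Blaschke factor of [t], whose modulus tends to 1 uniformly at the circle. As no boundary values
    are available, the bound is claimed for every m > 1 on an annulus. *)
Lemma schur_transform_bound h g t m : modulus t < 1 -> 1 < m ->
  (forall z, modulus z < 1 -> modulus (h z) <= 1) -> modulus (h t) < 1 ->
  (forall z, modulus z < 1 ->
    (h z - h t) * (1 - t^* * z) = g z * ((1 - (h t)^* * h z) * (z - t))) ->
  exists rho, [/\ 0 < rho, rho < 1 &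
    forall z, rho <= modulus z -> modulus z < 1 -> modulus (g z) <= m].
Proof.
move=> t1 m1 h1 ht1 hg; have t0 := modulus_ge0 t.
pose q := (1 - modulus t) / 2.
have q0 : 0 < q by rewrite /q; lra.
have m2 : 0 < (m ^+ 2 - 1) * q ^+ 2 by rewrite mulr_gt0 ?exprn_gt0 // expr2; nra.
(* The first radius gives |z - t| >= q, the second 2 (1 - |z|) <= (m^2 - 1) q^2; together they yield
   |1 - conj(t) z| <= m |z - t|. *)
exists (Num.max ((1 + modulus t) / 2) (1 - (m ^+ 2 - 1) * q ^+ 2 / 2)); split.
- by rewrite lt_max; apply/orP; left; lra.
- by rewrite gt_max; apply/andP; split; lra.
move=> z; rewrite ge_max => /andP[zq zm] z1.
have zt : q <= modulus (z - t).
  by have := modulusD (z - t) t; rewrite subrK /q; lra.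
have h2 : modulus (1 - t^* * z) <= m * modulus (z - t).
  rewrite -(@ler_pXn2r _ 2) ?nnegrE ?modulus_ge0 ?mulr_ge0 ?modulus_ge0 //; last lra.
  rewrite modulus_mobius exprMn.
  have : q ^+ 2 <= modulus (z - t) ^+ 2 by rewrite ler_pXn2r ?nnegrE ?modulus_ge0 // ltW.
  have := modulus_ge0 z; move: (modulus z) (modulus (z - t) ^+ 2) zm z1 => a b.
  move=> za a1 a0 qb.
  have e1 : (1 - modulus t ^+ 2) * (1 - a ^+ 2) <= 1 - a ^+ 2.
    have aa : 0 <= 1 - a ^+ 2 by rewrite expr2; nra.
    by have := mulr_ge0 (sqr_ge0 (modulus t)) aa; lra.
  have e2 : 1 - a ^+ 2 <= 2 * (1 - a) by rewrite expr2; nra.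
  have e3 : (m ^+ 2 - 1) * q ^+ 2 <= (m ^+ 2 - 1) * b.
    by apply: ler_wpM2l => //; rewrite expr2; nra.
  by lra.
have h3 : modulus (h z - h t) <= modulus (1 - (h t)^* * h z).
  rewrite -(@ler_pXn2r _ 2) ?nnegrE ?modulus_ge0 //.
  rewrite modulus_mobius lerDl mulr_ge0 // subr_ge0 expr_le1 ?modulus_ge0 //.
  - exact: ltW.
  - exact: h1.
have h4 : 0 < modulus (1 - (h t)^* * h z) * modulus (z - t).
  rewrite mulr_gt0 ?modulus_gt0 ?one_sub_conj_neq0 //; first exact: h1.
  by rewrite -modulus_gt0; lra.
rewrite -(ler_pM2r h4) -!modulusM -hg // !modulusM.
rewrite mulrCA; apply: ler_pM => //; exact: modulus_ge0.
Qed.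

Lemma schur_transform h t : disk_analytic h ->
  (forall z, modulus z < 1 -> modulus (h z) <= 1) ->
  modulus t < 1 -> modulus (h t) < 1 ->
  exists g, [/\ disk_analytic g, forall z, modulus z < 1 -> modulus (g z) <= 1 &
    forall z, modulus z < 1 ->
    (h z - h t) * (1 - t^* * z) = g z * ((1 - (h t)^* * h z) * (z - t))].
Proof.
move=> an h1 t1 ht1; set a := h t in ht1 *.
have a2 : 1 - a^* * a != 0 by apply: one_sub_conj_neq0 => //; exact: ltW.
have [r1 [b [E [M [pM1 b0 [e pE1 e0] H1]]]]] := analytic_at_diff (an t t1).
pose r := Num.min r1 (1 - modulus t).
have rr1 : r <= r1 by rewrite ge_min lexx.
have r0 : 0 < r by rewrite lt_min pM1.1; lra.
have pM := ps_le r0 rr1 pM1; have pE := ps_le r0 rr1 pE1.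
have H s : modulus s < r -> E s = (h (t + s) - a) * M s /\ modulus (t + s) < 1.
  rewrite lt_min => /andP[/H1 -> st]; split=> //.
  by have := modulusD t s; lra.
have [G pG EG] := ps_div pE e0.
(* The value at the removable singularity, since h'(t) = e_1 / b_0. *)
pose g0 := (1 - t^* * t) * e 1%N / ((1 - a^* * a) * b 0%N).
pose g z := if z == t then g0
  else (h z - a) * (1 - t^* * z) / ((1 - a^* * h z) * (z - t)).
have hg z : modulus z < 1 ->
    (h z - a) * (1 - t^* * z) = g z * ((1 - a^* * h z) * (z - t)).
  move=> z1; rewrite /g; case: eqVneq => [->|zt]; first by rewrite !subrr !mul0r !mulr0.
  by rewrite divfK // mulf_neq0 ?one_sub_conj_neq0 ?h1 // subr_eq0.
have ang : disk_analytic g.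
  move=> z0 z01; have [->|zt] := eqVneq z0 t.
    (* Near [t] the common factor z - t is cancelled: numerator (1 - conj(t) z) G, denominator (1 -
       conj(a) h) M written as (1 - conj(a) a) M - conj(a) E. *)
    have [c c0 pN] := ps_mul_lin (1 - t^* * t) (- t^*) pG.
    have pD := ps_lin (1 - a^* * a) (- a^*) pM pE.
    eexists r, c, _, _, _; split; [exact: pN|exact: pD| |].
      by rewrite /= e0 mulr0 addr0 mulf_neq0.
    move=> s sr; rewrite /g; case: eqVneq => [/eqP|st].
      rewrite addrC -subr_eq0 addrK => /eqP ->.
      rewrite (ps_at0 pG) (ps_at0 pM) (ps_at0 pE) e0 /g0 !mulr0 !addr0.
      by field; rewrite a2 b0.
    have s0 : s != 0 by apply: contra st => /eqP ->; rewrite addr0.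
    have [hE ts1] := H s sr; rewrite EG in hE.
    have hh : 1 - a^* * h (t + s) != 0 by rewrite one_sub_conj_neq0 // h1.
    have -> : G s = (h (t + s) - a) * M s / s by rewrite -hE; field.
    rewrite EG hE; field; apply/andP; split=> //.
    by rewrite addrAC subrr add0r.
  have [r2 [a' [b' [N' [M' [pN2 pM2 b'0 H2]]]]]] := an z0 z01.
  have zt' : 0 < modulus (z0 - t) by rewrite modulus_gt0 subr_eq0.
  pose r' := Num.min (Num.min r2 (modulus (z0 - t))) (1 - modulus z0).
  have r'2 : r' <= r2 by rewrite !ge_min lexx.
  have r'0 : 0 < r' by rewrite !lt_min pM2.1 zt'; lra.
  have pM' := ps_le r'0 r'2 pM2; have pN' := ps_le r'0 r'2 pN2.
  have [c c0 pN] := ps_mul_lin (1 - t^* * z0) (- t^*) (ps_lin 1 (- a) pN' pM').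
  have [d d0 pD] := ps_mul_lin (z0 - t) 1 (ps_lin 1 (- a^*) pM' pN').
  eexists r', c, d, _, _; split; [exact: pN|exact: pD| |].
    rewrite d0 -(ps_at0 pN') -(ps_at0 pM') H2 ?addr0 ?modulus0 ?pM2.1 //.
    rewrite mulf_neq0 ?subr_eq0 // (ps_at0 pM').
    have -> : 1 * b' 0%N + - a^* * (h z0 * b' 0%N) = (1 - a^* * h z0) * b' 0%N by ring.
    by rewrite mulf_neq0 // one_sub_conj_neq0 // h1.
  move=> s; rewrite !lt_min => /andP[/andP[/H2 -> s1] s2].
  have zs : z0 + s != t.
    apply/eqP => e'; move: s1; rewrite -e' opprD addrA subrr sub0r modulusN ltxx //.
  have zs1 : modulus (z0 + s) < 1 by have := modulusD z0 s; lra.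
  have hh : 1 - a^* * h (z0 + s) != 0 by rewrite one_sub_conj_neq0 // h1.
  by rewrite /g (negPf zs); field; rewrite hh andbT subr_eq0.
exists g; split=> // z z1; rewrite leNgt; apply/negP => gz.
(* A bound strictly between 1 and |g z|, contradicted by the maximum principle. *)
have [m1 mg] : 1 < (1 + modulus (g z)) / 2 /\ (1 + modulus (g z)) / 2 < modulus (g z).
  by split; lra.
have [rho [rho0 rho1 Hr]] := schur_transform_bound t1 m1 h1 ht1 hg.
have := max_principle ang rho0 rho1 _ Hr z1; lra.
Qed.

Lemma qformE n (A : 'M[C]_n) v :
  qform A v = \sum_i \sum_j (v i 0)^* * A i j * v j 0.
Proof.
rewrite /qform mxE exchange_big /=; apply: eq_bigr => j _.
by rewrite mxE mulr_suml; apply: eq_bigr => i _; rewrite adjmxE.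
Qed.

(** Elimination of one node: a rank-one kernel from the node [t], plus a positive multiple of the
    kernel of the Schur transform, conjugated by a factor [c] that vanishes at [t]. *)
Lemma pick_kernel_schur_step h g t x y : modulus t < 1 -> modulus x < 1 ->
  modulus y < 1 -> modulus (h t) < 1 ->
  (forall z, modulus z < 1 ->
    (h z - h t) * (1 - t^* * z) = g z * ((1 - (h t)^* * h z) * (z - t))) ->
  let c z := (z - t) * (1 - (h t)^* * h z) / (1 - t^* * z) in
  pick_kernel h x y = pick_kernel h x t * pick_kernel h t y / pick_kernel h t t +
    (1 - h t * (h t)^*)^-1 * (c x * pick_kernel g x y * (c y)^*).
Proof.
move=> t1 x1 y1 a1 hg c.
have ax := hg x x1; have := congr1 Num.conj (hg y y1).
rewrite !(rmorphB, rmorphM, rmorph1) /= !conjCK => ay.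
rewrite /c /pick_kernel !(rmorphB, rmorphM, rmorph1, fmorphV) /= !conjCK.
have n0 (u v : C) : modulus u < 1 -> modulus v < 1 -> 1 - u * v^* != 0.
  by move=> u1 v1; rewrite mulrC one_sub_conj_neq0 // ltW.
have nxt := n0 _ _ x1 t1; have nty := n0 _ _ t1 y1; have nxy := n0 _ _ x1 y1.
have ntt := n0 _ _ t1 t1; have naa := n0 _ _ a1 a1.
move: ax ay nxt nty nxy ntt naa; clear c n0 hg a1 t1 x1 y1.
(* Conjugates become independent variables, which leaves a rational identity modulo the two
   transform equations. *)
move: x t y^* t^* (h x) (h y)^* (g x) (g y)^* (h t) (h t)^*.
move=> {}x {}t y' t' hx hy gx gy a a' ax ay nxt nty nxy ntt naa.
have nxt' : 1 - t' * x != 0 by rewrite mulrC.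
transitivity (((x - t) * (y' - t') * (1 - a' * hx) * (1 - a * hy) -
   ((hx - a) * (1 - t' * x)) * ((hy - a') * (1 - t * y'))) /
   ((1 - a * a') * (1 - x * t') * (1 - t * y') * (1 - x * y')) +
   (1 - hx * a') * (1 - a * hy) * (1 - t * t') /
   ((1 - x * t') * (1 - t * y') * (1 - a * a'))).
  by field; rewrite nxt nty nxy naa.
rewrite ax ay; field.
by rewrite ?nxt ?nty ?nxy ?ntt ?naa ?nxt'.
Qed.

(** This is the limit r -> 1. Nonnegativity in the complex order includes being real: r = 0 shows it
    for [X], then r = 1/2 for [Y]. *)
Lemma psd_of_scaled (X Y : C) :
  (forall r : R, 0 <= r -> r < 1 -> 0 <= X - (r ^+ 2)%:C%C * Y) -> 0 <= X - Y.
Proof.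
move=> H; have h0 : 0 <= X.
  by have := H 0 (lexx _) ltr01; rewrite expr0n /= mul0r subr0.
have h1 : 0 <= X - ((2^-1 : R) ^+ 2)%:C%C * Y by apply: H; lra.
have Xr : X = (complex.Re X)%:C%C by rewrite RRe_real // ger0_real.
have Yr : Y = (complex.Re Y)%:C%C.
  rewrite RRe_real //; have -> : Y = 4 * (X - (X - ((2^-1 : R) ^+ 2)%:C%C * Y)).
    rewrite opprB addrC subrK mulrA (_ : 4 * _ = 1) ?mul1r //.
    have -> : (4 : C) = (4 : R)%:C%C by rewrite rmorph_nat.
    by rewrite -rmorphM -(rmorph1 (real_complex R)); congr (_%:C%C); field.
  by rewrite rpredM ?rpred_nat // rpredB ?ger0_real.
rewrite Xr Yr -rmorphB ler0c; rewrite Xr ler0c in h0.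
have {}H r : 0 <= r -> r < 1 -> 0 <= complex.Re X - r ^+ 2 * complex.Re Y.
  by move=> r0 r1; have := H r r0 r1; rewrite Xr Yr -rmorphM -rmorphB ler0c.
move: (complex.Re X) (complex.Re Y) h0 H => x y {Xr Yr h1} x0 H.
rewrite leNgt; apply/negP => xy; have y0 : 0 < y by lra.
(* If x < y, this r < 1 violates the hypothesis: r^2 y > x because (x + y)^2 > 4 x y. *)
pose r := (x + y) / (2 * y).
have ry : r * y = (x + y) / 2 by rewrite /r; field; lra.
have r0 : 0 <= r by rewrite divr_ge0; lra.
have r1 : r < 1 by rewrite ltr_pdivrMr; lra.
have := H r r0 r1; have : 0 < y * (y - x) by rewrite mulr_gt0; lra.
have e : r ^+ 2 * y * y = ((x + y) / 2) ^+ 2 by rewrite -ry; ring.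
move=> h1 h2; have := mulr_ge0 h2 (ltW y0); rewrite mulrBl e.
have : 0 < (y - x) ^+ 2 by rewrite exprn_gt0; lra.
rewrite !expr2; nra.
Qed.

(* Eliminating the node [z 0] turns the Pick matrix of [h]
   into that of its Schur transform; scaling by [r < 1] keeps [|h (z 0)| < 1]. *)
Lemma schur_pick_psd n h (z : 'I_n -> C) : disk_analytic h ->
  (forall z, modulus z < 1 -> modulus (h z) <= 1) ->
  (forall i, modulus (z i) < 1) -> forall v, 0 <= qform (pick_matrix h z) v.
Proof.
elim: n h z => [|n IH] h z an h1 z1 v; first by rewrite qformE big_ord0.
rewrite qformE.
pose W i j := (v i 0)^* * v j 0 / (1 - z i * (z j)^*).
suff H (r : R) : 0 <= r -> r < 1 ->
    0 <= \sum_i \sum_j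
      (v i 0)^* * pick_kernel (fun x => r%:C%C * h x) (z i) (z j) * v j 0.
  have -> : \sum_i \sum_j (v i 0)^* * pick_matrix h z i j * v j 0 =
      \sum_i \sum_j W i j - \sum_i \sum_j W i j * (h (z i) * (h (z j))^*).
    rewrite -sumrB; apply: eq_bigr => i _; rewrite -sumrB; apply: eq_bigr => j _.
    by rewrite mxE /W /pick_kernel; ring.
  apply: psd_of_scaled => r r0 r1; have := H r r0 r1; congr (0 <= _).
  rewrite mulr_sumr -sumrB; apply: eq_bigr => i _.
  rewrite mulr_sumr -sumrB; apply: eq_bigr => j _.
  rewrite /W /pick_kernel rmorphM /= (_ : (r%:C%C)^* = r%:C%C); last exact: conjc_real.
  by rewrite rmorphXn /=; ring.
move=> r0 r1; set k : C -> C := fun x => r%:C%C * h x.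
have k1 x : modulus x < 1 -> modulus (k x) <= r.
  move=> /h1 hx; rewrite modulusM modulus_real ger0_norm //.
  by rewrite -[leRHS]mulr1 ler_wpM2l.
set t := z ord0; have t1 : modulus t < 1 by exact: z1.
have kt1 : modulus (k t) < 1 by apply: le_lt_trans r1; exact: k1.
have kb x : modulus x < 1 -> modulus (k x) <= 1.
  by move=> /k1 kx; apply: le_trans (ltW r1).
have [g [ang g1 gk]] := schur_transform (disk_analytic_scale _ an) kb t1 kt1.
pose c x := (x - t) * (1 - (k t)^* * k x) / (1 - t^* * x).
have kk : 0 < 1 - k t * (k t)^*.
  by rewrite subr_gt0 -sqr_modulus -(rmorph1 (real_complex R)) ltcR expr_lt1 ?modulus_ge0.
have tt : 0 < 1 - t * t^*.
  by rewrite subr_gt0 -sqr_modulus -(rmorph1 (real_complex R)) ltcR expr_lt1 ?modulus_ge0.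
pose s := \sum_i (v i 0)^* * pick_kernel k (z i) t.
pose w : 'cV[C]_n := \col_i ((c (z (lift ord0 i)))^* * v (lift ord0 i) 0).
have -> : \sum_i \sum_j (v i 0)^* * pick_kernel k (z i) (z j) * v j 0 =
    s * s^* / pick_kernel k t t + (1 - k t * (k t)^*)^-1 *
    qform (pick_matrix g (fun i => z (lift ord0 i))) w.
  have -> : s * s^* / pick_kernel k t t = \sum_i \sum_j (v i 0)^* *
     (pick_kernel k (z i) t * pick_kernel k t (z j) / pick_kernel k t t) * v j 0.
    rewrite /s rmorph_sum /= mulr_suml mulr_suml; apply: eq_bigr => i _.
    rewrite mulr_sumr mulr_suml; apply: eq_bigr => j _.
    by rewrite rmorphM /= conjCK conj_pick_kernel; ring.
  have -> : qform (pick_matrix g (fun i => z (lift ord0 i))) w = \sum_i \sum_j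
     (v i 0)^* * (c (z i) * pick_kernel g (z i) (z j) * (c (z j))^*) * v j 0.
    (* The vanishing of [c] at the eliminated node drops the first row and column, leaving n points
       for the induction. *)
    have c0 : c (z ord0) = 0 by rewrite /c subrr !mul0r.
    rewrite big_ord_recl [X in _ = X + _]big1 ?add0r; last first.
      by move=> j _; rewrite c0 !(mul0r, mulr0).
    rewrite qformE; apply: eq_bigr => i _; rewrite big_ord_recl c0 conjC0.
    rewrite !(mul0r, mulr0) add0r; apply: eq_bigr => j _.
    by rewrite !mxE rmorphM /= conjCK; ring.
  rewrite mulr_sumr -big_split /=; apply: eq_bigr => i _.
  rewrite mulr_sumr -big_split /=; apply: eq_bigr => j _.
  by rewrite (pick_kernel_schur_step t1 (z1 i) (z1 j) kt1 gk) -/(c _) -/(c _); ring.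
apply: addr_ge0.
  by rewrite divr_ge0 ?mul_conjC_ge0 // divr_ge0 // ltW.
rewrite mulr_ge0 ?invr_ge0 ?(ltW kk) //; apply: IH => // i; exact: z1.
Qed.

End SchurAlgorithm.

(** * Schur functions and point configurations *)

Section Bridges.
Variable R : realType.
Local Notation C := R[i].
Local Notation modulus := (@modulus R).
Implicit Types (D : set C) (f g h : C -> C).

Lemma lt0c (k : R) : (0 < k%:C%C :> C) = (0 < k).
Proof. exact: (ltcR 0 k). Qed.

Lemma unit_diskE (z : C) : unit_disk z <-> modulus z < 1.
Proof. by rewrite /unit_disk /= norm_lt1. Qed.

Lemma open_modulus D z : open D -> D z ->
  exists2 d, 0 < d & forall w, modulus (w - z) < d -> D w.
Proof.
move=> oD Dz; have : nbhs z D by apply: open_nbhs_nbhs.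
move=> /nbhs_ballP[e /= e0 He]; exists (complex.Re e).
  by move: e0; rewrite ltcE => /andP[].
move=> w wd; apply: He; rewrite /ball /= distrC normE.
have -> : e = (complex.Re e)%:C%C by rewrite RRe_real // gtr0_real.
by rewrite ltcR.
Qed.

Lemma cvg_modulus (T : Type) (F : set_system T) (u : T -> C) (l : C) :
  Filter F -> (u x @[x --> F] --> l) <->
  (forall e : R, 0 < e -> F [set x | modulus (u x - l) < e]).
Proof.
move=> FF; split=> H.
  move=> e e0; have := (@cvgrPdist_lt C C^o T F FF u l).1 H e%:C%C.
  rewrite lt0c => /(_ e0); apply: filterS => x; rewrite normE ltcR /=.
  by rewrite modulusB.
apply/(@cvgrPdist_lt C C^o T F FF u l) => e e0.
have er : e = (complex.Re e)%:C%C by rewrite RRe_real // gtr0_real.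
have := H (complex.Re e); rewrite -lt0c -er => /(_ e0); apply: filterS => x /=.
by rewrite er normE ltcR modulusB.
Qed.

Lemma schur_disk_analytic (S : C -> C) : schur S -> disk_analytic S.
Proof.
move=> [anS _] z0 z01; have /anS[r [r0 [a Ha]]] : unit_disk z0 by apply/unit_diskE.
have rr : r = (complex.Re r)%:C%C by rewrite RRe_real // gtr0_real.
have r0' : 0 < complex.Re r by rewrite -lt0c -rr.
exists (complex.Re r), a, (fun k => if k is 0 then 1 else 0).
exists (fun t => S (z0 + t)), (fun=> 1).
split; [|exact: ps_const|exact: oner_neq0|by move=> t _; rewrite mulr1].
split=> // t tr e e0; have := Ha (z0 + t).
rewrite (addrC z0) addrK rr normE ltcR => /(_ tr).
move=> /(cvg_modulus _ _ _)/(_ e e0)[N _ HN].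
by exists N => M NM; exact: HN.
Qed.

Lemma schur_modulus (S : C -> C) z : schur S -> modulus z < 1 -> modulus (S z) <= 1.
Proof.
move=> [_ S1] /unit_diskE/S1.
by rewrite normE -(rmorph1 (real_complex R)) lecR.
Qed.

Lemma psdE n (A : 'M[C]_n) : psd A <-> forall v, 0 <= qform A v.
Proof. by split=> H v; have := H v; rewrite qformE. Qed.

Lemma pickE n f (z : 'I_n -> C) : Defs.pick f z = pick_matrix f z.
Proof. by []. Qed.

Lemma sq_minusP n f (z : 'I_n -> C) k :
  (k <= sq_minus (Defs.pick f z))%N <-> neg_subspace (pick_matrix f z) k.
Proof.
rewrite pickE /sq_minus; apply: neg_subspace_eigenvalues.
  exact: pick_matrix_herm.
by apply/eqP; exact: (xchooseP (char_poly_splits (pick_matrix f z))).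
Qed.

Lemma exists_near_avoiding D x (d : R) (L : seq C) : open D -> D x -> 0 < d ->
  exists w, [/\ D w, w \notin L & modulus (w - x) < d].
Proof.
move=> oD Dx d0; have [r r0 Hr] := open_modulus oD Dx.
(* The denominators k + 2 keep every candidate strictly closer than [m]; the candidates are
   distinct, so one more than the length of [L] cannot all lie in [L]. *)
pose m := Num.min d r; have m0 : 0 < m by rewrite lt_min d0.
pose pt k : C := x + (m / k.+2%:R)%:C%C.
have pt_near k : modulus (pt k - x) < m.
  rewrite /pt addrC addrA addNr add0r modulus_real gtr0_norm ?divr_gt0 //.
  rewrite ltr_pdivrMr // ltr_pMr // -[1]/(1%:R) ltr_nat //.
have pt_inj : injective pt.
  move=> i j /addrI/(@complexI R)/(mulfI (lt0r_neq0 m0))/invr_inj/eqP.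
  by rewrite eqr_nat => /eqP[].
have [w wL] : exists k, pt k \notin L.
  apply: contrapT => H.
  have : {subset [seq pt k | k <- iota 0 (size L).+1] <= L}.
    move=> _ /mapP[k _ ->]; apply: contrapT => kL; apply: H; exists k.
    exact/negP.
  move=> /uniq_leq_size; rewrite map_inj_uniq // iota_uniq size_map size_iota ltnn.
  by move=> /(_ isT).
have := pt_near w; rewrite lt_min => /andP[h1 h2].
by exists (pt w); split=> //; exact: Hr.
Qed.

Definition points_avoiding D (L : seq C) n (z : 'I_n -> C) :=
  injective z /\ forall i, D (z i) /\ z i \notin L.

Lemma extend_points D (L : seq C) a b (z : 'I_a -> C) : open D -> D !=set0 ->
  points_avoiding D L z -> (a <= b)%N ->
  exists (w : 'I_b -> C) (s : 'I_a -> 'I_b),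
    points_avoiding D L w /\ forall i, w (s i) = z i.
Proof.
move=> oD [x0 Dx0] Hz /subnKC <-; elim: (b - a)%N => [|k [w [s [[wi Hw] ws]]]].
  by rewrite addn0; exists z, id.
have [x [Dx xL _]] := exists_near_avoiding (L ++ codom w) oD Dx0 ltr01.
rewrite addnS; move: xL; rewrite mem_cat negb_or => /andP[xL xw].
have xw' i : w i <> x by move=> e; move: xw; rewrite -e codom_f.
exists (fun i => if unlift ord_max i is Some j then w j else x).
exists (fun i => lift ord_max (s i)); split; last by move=> i; rewrite liftK.
split=> [i j|i]; last by case: unliftP.
case: unliftP => [i' ->|->]; case: unliftP => [j' ->|->] //.
- by move/wi ->.
- by move/xw'.
- by move/esym/xw'.
Qed.

Lemma cvg_conj (T : Type) (F : set_system T) (u : T -> C) (l : C) : Filter F ->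
  (u x @[x --> F] --> l) -> ((u x)^* @[x --> F] --> l^*).
Proof.
move=> FF /(cvg_modulus _ _ _) H; apply/(cvg_modulus _ _ _) => e /H.
by apply: filterS => x /=; rewrite -rmorphB modulus_conj.
Qed.

Lemma cvg_ge0 (T : Type) (F : set_system T) (u : T -> C) (l : C) : ProperFilter F ->
  (u x @[x --> F] --> l) -> F [set x | 0 <= u x] -> 0 <= l.
Proof.
move=> FF /(cvg_modulus _ _ _) H Fu.
have key e : 0 < e -> exists2 y : C, 0 <= y & modulus (y - l) < e.
  move=> /H h; have [x [xe x0]] := filter_ex (filterI h Fu); by exists (u x).
rewrite lecE; apply/andP; split.
  apply/eqP; apply: contrapT => /eqP l0.
  have [|y y0] := key (`|complex.Im l|); first by rewrite normr_gt0.
  apply/negP; rewrite -leNgt; apply: le_trans (Im_le_modulus _).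
  move: y0; rewrite lecE => /andP[/eqP y0 _].
  case: y y0 => a b; case: l l0 {H key} => c d /= _ ->.
  by rewrite sub0r normrN.
rewrite leNgt; apply/negP => l0.
have [|y y0] := key (- complex.Re l); first by rewrite oppr_gt0.
apply/negP; rewrite -leNgt; apply: le_trans (Re_le_modulus _).
move: y0; rewrite lecE => /andP[_ y0].
case: y y0 => a b; case: l l0 {H key} => c d /= l0 y0.
by rewrite ger0_norm; lra.
Qed.

Lemma cvg_finsum (I : Type) (r : seq I) (T : Type) (F : set_system T) (u : I -> T -> C)
  (l : I -> C) : Filter F -> (forall i, u i x @[x --> F] --> l i) ->
  \sum_(i <- r) u i x @[x --> F] --> \sum_(i <- r) l i.
Proof.
move=> FF H; elim: r => [|i r IH].
  rewrite big_nil; apply/(cvg_modulus _ _ _) => e e0.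
  by apply: filterE => x; rewrite /= big_nil subrr modulus0.
rewrite big_cons; under eq_fun do rewrite big_cons.
exact: (@cvgD C C^o T F FF (u i) (fun x => \sum_(j <- r) u j x) (l i) _ (H i) IH).
Qed.

End Bridges.

(** * Extension to the nodes *)

Section Extension.
Variables (R : realType) (D : set R[i]) (p : nat).
Local Notation C := R[i].
Local Notation modulus := (@modulus R).
Implicit Types (g : C -> C) (L : seq C).
Hypotheses (oD : open D) (D1 : D `<=` @unit_disk R) (p0 : (0 < p)%N).

Definition pick_psd_avoiding L g := forall z : 'I_p -> C, points_avoiding D L z ->
  forall v, 0 <= qform (pick_matrix g z) v.

Lemma D_modulus z : D z -> modulus z < 1.
Proof. by move=> /D1/unit_diskE. Qed.

Lemma qform_delta n (A : 'M[C]_n) i : qform A (delta_mx i 0) = A i i.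
Proof.
rewrite qformE (bigD1 i) //= [X in _ + X]big1 ?addr0 => [|j ji]; last first.
  by apply: big1 => k _; rewrite !mxE (negPf ji) /= conjC0 !mul0r.
rewrite (bigD1 i) //= big1 ?addr0 => [|j ji].
  by rewrite !mxE !eqxx /= conjC1 mul1r mulr1.
by rewrite [delta_mx i 0 j 0]mxE (negPf ji) mulr0.
Qed.

(** Turns statements about p-tuples into statements about a single point, read off a diagonal
    entry. *)
Lemma avoiding_point L w : D w -> w \notin L ->
  exists (z : 'I_p -> C) i, points_avoiding D L z /\ z i = w.
Proof.
move=> Dw wL; have Hw : points_avoiding D L (fun _ : 'I_1 => w).
  by split=> // i j _; rewrite !ord1.
have [z [s [Hz zs]]] := extend_points oD (ex_intro _ w Dw) Hw p0.
by exists z, (s ord0); split.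
Qed.

Lemma sqr_modulus_kernel g w : modulus w < 1 -> 0 <= pick_kernel g w w ->
  modulus (g w) <= 1.
Proof.
move=> w1; rewrite /pick_kernel -!sqr_modulus.
rewrite -(rmorph1 (real_complex R)) -!rmorphB -fmorphV -rmorphM ler0c.
have w2 : 0 < 1 - modulus w ^+ 2 by rewrite subr_gt0 expr_lt1 ?modulus_ge0.
by rewrite pmulr_lge0 ?invr_gt0 // subr_ge0 expr_le1 ?modulus_ge0.
Qed.

Lemma pick_psd_bound L g w : pick_psd_avoiding L g -> D w -> w \notin L ->
  modulus (g w) <= 1.
Proof.
move=> gL Dw wL; have [z [i [Hz <-]]] := avoiding_point Dw wL.
apply: sqr_modulus_kernel; first exact: D_modulus (Hz.2 i).1.
by have := gL z Hz (delta_mx i 0); rewrite qform_delta mxE.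
Qed.

(* Positivity of the Pick matrices is a closed condition, so any cluster value of
   the bounded function [g] at [x] will do. *)
Lemma pick_psd_extend L g x : pick_psd_avoiding (x :: L) g ->
  exists2 g', pick_psd_avoiding L g' & forall z, z != x -> g' z = g z.
Proof.
move=> gL; have [xD|xD] := pselect (D x); last first.
  exists g => // z [zi Hz]; apply: gL; split=> // i; have [Dz zL] := Hz i.
  split=> //; rewrite inE negb_or zL andbT; apply/eqP => e; apply: xD.
  by rewrite -e.
have [xL|xL] := boolP (x \in L).
  exists g => // z [zi Hz]; apply: gL; split=> // i; have [Dz zL] := Hz i.
  split=> //; rewrite inE negb_or zL andbT; apply/eqP => e.
  by move: zL; rewrite e xL.
(* The points [w] tend to [x] while avoiding any prescribed finite list, so a single cluster value
   [c] serves every tuple [z] considered later. *)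
pose B (Md : seq C * R) :=
  [set w | [/\ D w, w \notin x :: L ++ Md.1 & modulus (w - x) < Md.2]].
pose F := filter_from [set Md : seq C * R | 0 < Md.2] B.
have PF : ProperFilter F.
  apply: filter_from_proper; last first.
    move=> [M d] /= d0.
    by have [w Hw] := exists_near_avoiding (x :: L ++ M) oD xD d0; exists w.
  apply: filter_from_filter; first by exists ([::], 1) => /=.
  move=> [M d] [N e] /= d0 e0; exists (M ++ N, Num.min d e).
    by rewrite /= lt_min d0.
  move=> w [Dw /=]; rewrite lt_min inE !mem_cat !negb_or.
  move=> /and4P[wx wL wM wN] /andP[wd we].
  by split; split=> //=; rewrite inE mem_cat !negb_or wx wL.
have [|c cl] := @disk_cluster R (g @ F) 1 _.
  exists ([::], 1) => //= w [Dw]; rewrite /= cats0 => wL _.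
  exact: (pick_psd_bound gL).
have near_c M d e : 0 < d -> 0 < e -> exists w, B (M, d) w /\ modulus (g w - c) < e.
  move=> d0 e0; have [||_ [w Bw <-] wc] := cl (g @` B (M, d)) e => //.
    by exists (M, d) => //= w Bw; exists w.
  by exists w.
exists (fun z => if z == x then c else g z); last by move=> z /negPf ->.
move=> z [zi Hz] v; have [[i0 zi0]|nx] := pselect (exists i, z i = x); last first.
  rewrite (_ : pick_matrix _ z = pick_matrix g z).
    apply: gL; split=> // i; have [Dz zL] := Hz i.
    by split=> //; rewrite inE negb_or zL andbT; apply/eqP => e; apply: nx; exists i.
  have zx i : (z i == x) = false by apply/eqP => e; apply: nx; exists i.
  by apply/matrixP => i j; rewrite !mxE /pick_kernel !zx.
have zx i : (z i == x) = (i == i0) by rewrite -zi0 (inj_eq zi).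
pose M := codom z.
(* Refines the approach so that [w] tends to [x] and g(w) to [c] simultaneously, with [w] off the
   tuple; replacing [x] by [w] then keeps the points distinct. *)
pose B' d := [set w | B (M, d) w /\ modulus (g w - c) < d].
pose F' := filter_from [set d : R | 0 < d] B'.
have PF' : ProperFilter F'.
  apply: filter_from_proper; last first.
    by move=> d /= d0; have [w Hw] := near_c M d d d0 d0; exists w.
  apply: filter_from_filter; first by exists 1 => /=.
  move=> d e /= d0 e0; exists (Num.min d e); first by rewrite /= lt_min d0.
  move=> w [[Dw wL /=]]; rewrite !lt_min => /andP[w1 w2] /andP[w3 w4].
  by split; split.
pose Z w i := if i == i0 then w else z i.
pose G w i := if i == i0 then g w else g (z i).
pose q w := \sum_i \sum_j (v i 0)^* *
  ((1 - G w i * (G w j)^*) / (1 - Z w i * (Z w j)^*)) * v j 0.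
have cvgZ i : Z w i @[w --> F'] --> z i.
  apply/(cvg_modulus _ _ _) => e e0; exists e => // w [[_ _ wx] _] /=.
  by rewrite /Z; case: eqP => [->|_]; rewrite ?zi0 ?subrr ?modulus0.
have cvgG i : G w i @[w --> F'] --> (if z i == x then c else g (z i)).
  apply/(cvg_modulus _ _ _) => e e0; exists e => // w [_ wc] /=.
  by rewrite /G zx; case: eqP => [_|_]; rewrite ?subrr ?modulus0.
have ccst (a : C) : (a : C) @[_ --> F'] --> a by exact: (@cvg_cst C^o).
have cq : q w @[w --> F'] -->
    qform (pick_matrix (fun z => if z == x then c else g z) z) v.
  rewrite qformE; apply: cvg_finsum => i; apply: cvg_finsum => j.
  rewrite mxE; apply: (@cvgM C C F' _); last exact: ccst.
  apply: (@cvgM C C F' _); first exact: ccst.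
  apply: (@cvgM C C F' _).
    apply: (@cvgB C C^o C F' _); first exact: ccst.
    by apply: (@cvgM C C F' _) => //; apply: cvg_conj.
  apply: (@cvgV C C F' _).
    by apply: one_sub_mul_conj_neq0; rewrite norm_lt1; apply/D_modulus/(Hz _).1.
  apply: (@cvgB C C^o C F' _); first exact: ccst.
  by apply: (@cvgM C C F' _) => //; apply: cvg_conj.
apply: (cvg_ge0 PF' cq); exists 1 => //= w [[Dw wL _] _].
move: wL; rewrite inE mem_cat !negb_or => /and3P[wx wL wz].
have := gL (Z w) _ v; rewrite qformE => H.
rewrite /= /q (eq_bigr (fun i => \sum_j (v i 0)^* * pick_matrix g (Z w) i j * v j 0)).
  apply: H; split=> [i j|i].
    rewrite /Z; case: eqP => [->|_]; case: eqP => [->|_] //.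
    - by move=> e; move: wz; rewrite e codom_f.
    - by move=> e; move: wz; rewrite -e codom_f.
    - exact: zi.
  rewrite /Z; case: eqP => [_|ii]; first by split=> //; rewrite inE negb_or wx.
  by split; [exact: (Hz i).1|rewrite inE negb_or zx (Hz i).2 andbT; apply/eqP].
move=> i _; apply: eq_bigr => j _; congr (_ * _ * _).
by rewrite mxE /pick_kernel /G /Z; case: eqP; case: eqP.
Qed.

End Extension.

(** * Reduction to the Hindmarsh property *)

Section Elimination.
Variable R : realType.
Local Notation C := R[i].
Local Notation modulus := (@modulus R).

Definition join_points n m (z : 'I_n -> C) (x : 'I_m -> C) (i : 'I_(n + m)) : C :=
  match fintype.split i with inl a => z a | inr b => x b end.

Variables (f : C -> C) (n : nat) (z : 'I_n -> C).
Hypotheses (z1 : forall i, modulus (z i) < 1) (uP : pick_matrix f z \in unitmx).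
Local Notation P := (pick_matrix f z).

Definition cross_pick m (x : 'I_m -> C) : 'M[C]_(n, m) :=
  \matrix_(i, j) pick_kernel f (z i) (x j).

Lemma pick_join m (x : 'I_m -> C) : pick_matrix f (join_points z x) =
  block_mx P (cross_pick x) (adjmx (cross_pick x)) (pick_matrix f x).
Proof.
apply/matrixP => i j; rewrite -(fintype.splitK i) -(fintype.splitK j) [LHS]mxE.
rewrite /join_points !fintype.unsplitK.
case: (fintype.split i) => a; case: (fintype.split j) => b /=;
  rewrite ?(block_mxEul, block_mxEur, block_mxEdl, block_mxEdr);
  by rewrite ?adjmxE !mxE ?conj_pick_kernel.
Qed.

Definition pick_quot w := pick_num f z w / pick_den f z w.

Lemma schur_compl_pick m (x : 'I_m -> C) i j : (forall i, modulus (x i) < 1) ->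
  schur_compl P (cross_pick x) (pick_matrix f x) i j =
  (pick_den f z (x i) * (pick_den f z (x j))^* -
   pick_num f z (x i) * (pick_num f z (x j))^*) / (1 - x i * (x j)^*).
Proof.
move=> x1; rewrite -pick_kernel_schur ?norm_lt1 //; last first.
  by move=> k; rewrite norm_lt1.
rewrite /schur_compl !(addmxE, oppmxE) [pick_matrix _ _ _ _]mxE; congr (_ - _).
have -> : pick_row f z (x i) = row i (adjmx (cross_pick x)).
  by apply/rowP => k; rewrite !mxE conj_pick_kernel.
have -> : adjmx (pick_row f z (x j)) = col j (cross_pick x).
  by apply/colP => k; rewrite !mxE conj_pick_kernel.
rewrite -row_mul mxE [RHS]mxE; apply: eq_bigr => k _.
by rewrite [row _ _ _ _]mxE [col _ _ _ _]mxE.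
Qed.

(** Dividing by the denominators is a diagonal congruence, which is the sense in which the Schur
    complement is a Pick matrix of the quotient. *)
Lemma qform_schur_compl m (x : 'I_m -> C) v : (forall i, modulus (x i) < 1) ->
  (forall i, pick_den f z (x i) != 0) ->
  qform (schur_compl P (cross_pick x) (pick_matrix f x)) v =
  qform (pick_matrix pick_quot x) (\col_i ((pick_den f z (x i))^* * v i 0)).
Proof.
move=> x1 d0; rewrite !qformE; apply: eq_bigr => i _; apply: eq_bigr => j _.
rewrite schur_compl_pick // !mxE rmorphM /= conjCK /pick_kernel /pick_quot.
rewrite rmorphM fmorphV /=.
have n0 : 1 - x i * (x j)^* != 0 by rewrite one_sub_mul_conj_neq0 ?norm_lt1.
have di := d0 i; have dj : (pick_den f z (x j))^* != 0.
  rewrite conjC_eq0; exact: d0.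
move: (pick_den f z (x i)) di (pick_den f z (x j))^* dj => di di0 dj dj0.
by field; rewrite di0 dj0 n0.
Qed.

(** Nonnegativity says |num| <= |den|, so a zero of the denominator would be a common zero. *)
Lemma pick_den_neq0 w : modulus w < 1 -> w \notin codom z ->
  0 <= (pick_den f z w * (pick_den f z w)^* -
        pick_num f z w * (pick_num f z w)^*) / (1 - w * w^*) ->
  pick_den f z w != 0.
Proof.
move=> w1 wz; rewrite -!sqr_modulus -(rmorph1 (real_complex R)) -!rmorphB -fmorphV.
rewrite -rmorphM ler0c pmulr_lge0; last first.
  by rewrite invr_gt0 subr_gt0 expr_lt1 ?modulus_ge0.
rewrite subr_ge0 => h; apply/eqP => d0.
apply: (@pick_num_den_neq0 _ f _ z _ uP w).
- by move=> i; rewrite norm_lt1.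
- by rewrite norm_lt1.
- by move=> i; apply: contra wz => /eqP ->; exact: codom_f.
split=> //; apply/eqP; rewrite -[_ == _]negbK -modulus_gt0; apply/negP => n0.
by move: h; rewrite d0 modulus0 expr0n /= leNgt exprn_gt0.
Qed.

End Elimination.

(** * Bounding the negative squares of arbitrary Pick matrices *)

Section Reduction.
Variables (R : realType) (D : set R[i]) (p : nat) (f : R[i] -> R[i]).
Local Notation C := R[i].
Local Notation modulus := (@modulus R).
Hypotheses (oD : open D) (D1 : D `<=` @unit_disk R) (p0 : (0 < p)%N).
Hypothesis hD : hindmarsh p D.

Lemma pick_psd_extend_seq (L : seq C) g : pick_psd_avoiding D p L g ->
  exists2 g', pick_psd_avoiding D p [::] g' & forall w, w \notin L -> g' w = g w.
Proof.
elim: L g => [|x L IH] g gL; first by exists g.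
have [g1 g1L g1E] := pick_psd_extend oD D1 p0 gL; have [g2 g2L g2E] := IH g1 g1L.
by exists g2 => // w; rewrite inE negb_or => /andP[wx wL]; rewrite g2E // g1E.
Qed.

Lemma neg_subspace_pick_le n (z : 'I_n -> C) k m (x : 'I_m -> C) :
  points_in D z -> pick_matrix f z \in unitmx -> neg_subspace (pick_matrix f z) k ->
  (forall w : 'I_(n + p) -> C, points_in D w -> ~ neg_subspace (pick_matrix f w) k.+1) ->
  (forall i, D (x i)) ->
  forall l, neg_subspace (pick_matrix f x) l -> neg_subspace (pick_matrix f z) l.
Proof.
move=> [zi zD] uP nP nw xD l nx.
have z1 i : modulus (z i) < 1 by apply: (D_modulus D1).
have hP : adjmx (pick_matrix f z) = pick_matrix f z by exact: pick_matrix_herm.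
pose g := pick_quot f z.
have scP (y : 'I_p -> C) : points_avoiding D (codom z) y -> forall v,
    0 <= qform (schur_compl (pick_matrix f z) (cross_pick f z y) (pick_matrix f y)) v.
  move=> [yi yD]; apply: (schur_compl_psd hP uP _ nP); first exact: pick_matrix_herm.
  rewrite -pick_join; apply: nw; split=> [i j|i]; last first.
    by rewrite /join_points; case: fintype.split => a //; exact: (yD a).1.
  rewrite -(fintype.splitK i) -(fintype.splitK j) /join_points !fintype.unsplitK.
  case: (fintype.split i) => a; case: (fintype.split j) => b /=.
  - by move/zi ->.
  - by move=> e; have := (yD b).2; rewrite -e codom_f.
  - by move=> e; have := (yD a).2; rewrite e codom_f.
  - by move/yi ->.
have den0 w : D w -> w \notin codom z -> pick_den f z w != 0.
  move=> Dw wz; have [y [i [Hy <-]]] := avoiding_point oD p0 Dw wz.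
  have y1 j : modulus (y j) < 1 by exact: D_modulus D1 _ (Hy.2 j).1.
  apply: pick_den_neq0 => //; first exact: (Hy.2 i).2.
  by have := scP y Hy (delta_mx i 0); rewrite qform_delta schur_compl_pick.
have gL : pick_psd_avoiding D p (codom z) g.
  move=> y Hy v.
  have y1 j : modulus (y j) < 1 by exact: D_modulus D1 _ (Hy.2 j).1.
  have dy j : pick_den f z (y j) != 0.
    by apply: den0; [exact: (Hy.2 j).1|exact: (Hy.2 j).2].
  have := scP y Hy (\col_i (v i 0 / (pick_den f z (y i))^*)).
  rewrite qform_schur_compl //; congr (0 <= qform _ _); apply/colP => i.
  by rewrite !mxE mulrCA divff ?mulr1 // conjC_eq0.
have [g' g'psd g'E] := pick_psd_extend_seq gL.
have [|S [sS SE]] := hD (g := g').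
  move=> y [yi yD]; rewrite pickE; apply/psdE; apply: g'psd.
  by split=> // i; split.
(* Points of [x] that are nodes are already in [z]; only the others are joined, and [x] is recovered
   as a selection through [t]. *)
pose s := [seq w <- codom x | w \notin codom z].
pose y (i : 'I_(size s)) := s`_i.
have yP i : D (y i) /\ y i \notin codom z.
  have : y i \in s by exact: mem_nth.
  by rewrite mem_filter => /andP[yz /codomP[j yj]]; split=> //; rewrite yj.
have y1 i : modulus (y i) < 1 by exact: D_modulus D1 _ (yP i).1.
have [t xt] : exists t : 'I_m -> 'I_(n + size s), forall i, x i = join_points z y (t i).
  suff H i : exists j, x i = join_points z y j by exact: (fin_all_exists H).
  have [/codomP[a xa]|xz] := boolP (x i \in codom z).
    by exists (fintype.unsplit (inl a)); rewrite /join_points fintype.unsplitK.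
  have xs : x i \in s by rewrite mem_filter xz codom_f.
  have lt_i : (index (x i) s < size s)%N by rewrite index_mem.
  exists (fintype.unsplit (inr (Ordinal lt_i))).
  by rewrite /join_points fintype.unsplitK /y /= nth_index.
have : neg_subspace (pick_matrix f (join_points z y)) l.
  apply: (neg_subspace_sub (s := t)); rewrite (_ : mxsub _ _ _ = pick_matrix f x) //.
  by apply/matrixP => i j; rewrite !mxE !xt.
rewrite pick_join; apply: neg_subspace_schur => // v.
rewrite qform_schur_compl //; last first.
  by move=> i; apply: den0; [exact: (yP i).1|exact: (yP i).2].
rewrite (_ : pick_matrix _ _ = pick_matrix S y); last first.
  apply/matrixP => i j; rewrite !mxE /pick_kernel.
  by have [Dj zj] := yP j; have [Di zi'] := yP i; rewrite !SE ?g'E.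
apply: schur_pick_psd => //; first exact: schur_disk_analytic.
by move=> w; exact: schur_modulus.
Qed.

(** Points are deleted as long as the matrix is singular, without losing negative directions; the
    process stops at the latest at the empty matrix, of determinant 1. *)
Lemma exists_unit_pick n (z : 'I_n -> C) k : points_in D z ->
  neg_subspace (pick_matrix f z) k -> exists n0 (z0 : 'I_n0 -> C),
  [/\ (n0 <= n)%N, points_in D z0, pick_matrix f z0 \in unitmx &
      neg_subspace (pick_matrix f z0) k].
Proof.
elim: n z => [|n IH] z Hz nz.
  by exists 0%N, z; split=> //; rewrite unitmxE det_mx00 unitr1.
have [uP|uP] := boolP (pick_matrix f z \in unitmx); first by exists n.+1, z.
have [i ni] := neg_subspace_singular (pick_matrix_herm f z) uP nz.
have [||n0 [z0 [le_n0 Hz0 uz0 nz0]]] := IH (fun j => z (lift i j)).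
- by split=> [j l /Hz.1/lift_inj|j] //; exact: Hz.2.
- by rewrite (_ : pick_matrix _ _ = mxsub (lift i) (lift i) (pick_matrix f z)) //;
    apply/matrixP => a b; rewrite !mxE.
by exists n0, z0; split=> //; exact: leqW.
Qed.

Lemma extend_points_in a b (z : 'I_a -> C) : D !=set0 -> points_in D z -> (a <= b)%N ->
  exists w : 'I_b -> C, points_in D w /\
    forall k, neg_subspace (pick_matrix f z) k -> neg_subspace (pick_matrix f w) k.
Proof.
move=> D0 [zi zD] ab; have Hz : points_avoiding D [::] z by split.
have [w [s [[wi wD] ws]]] := extend_points oD D0 Hz ab.
exists w; split=> [|k]; first by split=> // i; exact: (wD i).1.
move=> nz; apply: (neg_subspace_sub (s := s)).
rewrite (_ : mxsub _ _ _ = pick_matrix f z) //.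
by apply/matrixP => i j; rewrite !mxE !ws.
Qed.

End Reduction.

Theorem theorem6p3 (R : realType) (p : nat) (D : set R[i]) (f : R[i] -> R[i])
    (kappa : nat) :
  (3 <= p)%N -> open D -> D `<=` @unit_disk R -> hindmarsh p D ->
  (S_kappa D kappa f <->
   exists n : nat, kn_eq D f n kappa /\ kn_eq D f (n + p) kappa).
Proof.
move=> p3 oD D1 hD; have p0 : (0 < p)%N by exact: leq_trans p3.
split.
  move=> [bd [n [z [n0 [Hz sz]]]]].
  have D0 : D !=set0 by exists (z (Ordinal n0)); exact: Hz.2.
  (* The size realising [kappa] works: p added points cannot lower the count, and membership in the
     class bounds it. *)
  exists n; split; split; [by exists z|by move=> w; exact: bd| |]; last first.
    by move=> w; apply: bd; rewrite addn_gt0 n0.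
  have [w [Hw nw]] := extend_points_in f oD D0 Hz (leq_addr p n).
  exists w; split=> //; apply/eqP; rewrite eqn_leq bd ?addn_gt0 ?n0 //=.
  by apply/sq_minusP/nw/sq_minusP; rewrite sz.
move=> [n [[[z [Hz sz]] _] [[w [Hw sw]] bd]]].
have np0 : (0 < n + p)%N by rewrite addn_gt0 p0 orbT.
(* Read off [w], since [z] is empty when n = 0. *)
have D0 : D !=set0 by exists (w (Ordinal np0)); exact: Hw.2.
have bd' a (x : 'I_a -> R[i]) k : (a <= n + p)%N -> points_in D x ->
    neg_subspace (pick_matrix f x) k -> (k <= kappa)%N.
  move=> le_a Hx nx; have [y [Hy ny]] := extend_points_in f oD D0 Hx le_a.
  by apply: leq_trans (bd y Hy); apply/sq_minusP/ny.
split; last by exists (n + p)%N, w.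
have nz : neg_subspace (pick_matrix f z) kappa by apply/sq_minusP; rewrite sz.
have [n1 [z1 [le_n1 Hz1 uz1 nz1]]] := exists_unit_pick Hz nz.
move=> m x _ Hx.
apply: (bd' n1 z1) => //; first exact: leq_trans le_n1 (leq_addr _ _).
apply: (neg_subspace_pick_le oD D1 p0 hD Hz1 uz1 nz1 _ Hx.2); last exact/sq_minusP.
(* A (kappa+1)-dimensional negative subspace on n1 + p <= n + p points would contradict the known
   bound. *)
move=> y Hy ny; have := bd' _ y _ _ Hy ny; rewrite leq_add2r => /(_ le_n1).
by rewrite ltnn.
Qed.
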